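(* Let $\varphi\in C^{\infty}(\mathbb{R})$ be an even function such that $\varphi''(\sigma)>0$ for every $\sigma\in[0,1)$, $\varphi''(1)=0$, $\varphi''(\sigma)<0$ for every $\sigma>1$, and $\varphi'''(1)<0$. Let $0<r_{1}\leq r_{3}<r_{4}\leq r_{2}$ and $T>0$ be real numbers. Let $u\in C^{1}\left((r_{1},r_{2})\times[0,T)\right)$ be a function satisfying $$u_{t}=\left(\varphi'(u_{r})\right)_{r}+\frac{\varphi'(u_{r})}{r}\quad\text{in }(r_{1},r_{2})\times[0,T),$$ and such that $$|u_{r}(r,0)|<1\quad\quad\forall r\in(r_{3},r_{4}).$$ Let $k_{0}:=r_{2}^{-1}\sqrt{2\varphi'(1)|\varphi'''(1)|}$, and let $$\mathcal{D}:=\{(r,t)\in(r_{1},r_{2})\times[0,T):\ r_{3}-k_{0}t<r<r_{4}+k_{0}t\}.$$ Then $|u_{r}(r,t)|<1$ for every $(r,t)\in\mathcal{D}$.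
   Context: Subscripts $r,t$ denote partial derivatives (one-sided in $t$ at $t=0$). Since $u$ is only assumed to be of class $C^{1}$, the equation is understood in the following sense: for every $t$ the function $r\mapsto\varphi'(u_{r}(r,t))$ is differentiable, and its derivative $(\varphi'(u_r))_r$ satisfies the equation at every point $(r,t)\in(r_1,r_2)\times[0,T)$. *)

(* Defs.v *)
From Stdlib Require Import Reals.
From Coquelicot Require Import Coquelicot.
Open Scope R_scope.

Definition smooth (f : R -> R) : Prop :=
  forall (n : nat) (x : R), ex_derive_n f n x.

Definition cylinder (r1 r2 T : R) (p : R * R) : Prop :=
  r1 < fst p < r2 /\ 0 <= snd p < T.

Definition partial_r (u : R -> R -> R) (r t : R) : R :=
  Derive (fun x => u x t) r.

(* [is_derive] with increments restricted to times in [0, T): this is the usual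
   derivative for 0 < t < T and the right derivative at t = 0. *)
Definition is_partial_t (T : R) (u : R -> R -> R) (r t l : R) : Prop :=
  filterdiff (fun s => u r s) (within (fun s => 0 <= s < T) (locally t))
    (fun h => scal h l).

(* [u] is a total function, but only its values on the cylinder matter. *)
Definition C1_cylinder (r1 r2 T : R) (u : R -> R -> R) : Prop :=
  continuous_on (cylinder r1 r2 T) (fun p => u (fst p) (snd p)) /\
  (forall r t, cylinder r1 r2 T (r, t) -> ex_derive (fun x => u x t) r) /\
  continuous_on (cylinder r1 r2 T) (fun p => partial_r u (fst p) (snd p)) /\
  exists ut : R -> R -> R,
    (forall r t, cylinder r1 r2 T (r, t) -> is_partial_t T u r t (ut r t)) /\
    continuous_on (cylinder r1 r2 T) (fun p => ut (fst p) (snd p)).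

Definition flux (phi : R -> R) (u : R -> R -> R) (r t : R) : R :=
  Derive phi (partial_r u r t).

Definition radial_equation (phi : R -> R) (r1 r2 T : R) (u : R -> R -> R) : Prop :=
  forall r t, cylinder r1 r2 T (r, t) ->
    ex_derive (fun x => flux phi u x t) r /\
    is_partial_t T u r t (partial_r (flux phi u) r t + flux phi u r t / r).

Definition speed (phi : R -> R) (r2 : R) : R :=
  / r2 * sqrt (2 * Derive phi 1 * Rabs (Derive_n phi 3 1)).

Definition expanding_region (k0 r1 r2 r3 r4 T : R) (p : R * R) : Prop :=
  cylinder r1 r2 T p /\ r3 - k0 * snd p < fst p < r4 + k0 * snd p.

(* Main.v *)
Require Import Defs.
From Stdlib Require Import Reals Lra Psatz Classical ClassicalEpsilon.
From Coquelicot Require Import Coquelicot.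
Open Scope R_scope.

(** Write [g] for the derivative of [phi], [v] for the slope [u_r], and let
    [c = g 1] and [m = - phi''' 1]. Where [Rabs v < 1] the equation is parabolic
    and the gap [z = c - g v] formally solves
    [z_t = phi'' v * (z_rr + z_r / r - z / r^2 + c / r^2)], where [phi'' v] is
    about [sqrt (2 m z)]. The source [c / r^2], due to the radial term, keeps
    pushing [z] away from [0], and [z > 0] together with continuity keeps the
    slope subcritical. A compactly supported bump that travels with speed
    [kappa] is a subsolution, with positive slope at the edges of its support,
    as soon as [Rabs kappa] is less than [k0 = sqrt (2 c m) / r2] and the bump
    is small.

    A point of the region is joined to the initial interval by a segment of
    speed [Rabs kappa < k0] ([oblique_segment]), and a thin tube is taken around
    it. In this tube the bump gives a barrier [B] for [v], with [B < 1] inside and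
    [B = 1] at the edges ([barrier_of_profile], resting on the explicit profile of
    [profile_subsolution] and on the square root behaviour of
    [degenerate_flux_gap]).

    As [u] is only of class C1, the equation for [z] is not available. The
    comparison [v <= B] is obtained instead by maximising the two-point function
    [(u - psi) y t - (u - psi) x t] over [x <= y], where [psi' = B]
    ([comparison]). The lateral boundary of the tube is harmless while
    [Rabs v <= 1]: where [v = 1] the flux [g v] is at a local maximum, so that its
    derivative vanishes, while the barrier has a flux derivative of the right
    sign.

    The condition [Rabs v <= 1] is recovered by continuation in time
    ([subcritical_tube]). At a first time with [Rabs v = 1] the contact would take
    place at an edge of the tube, where the vanishing derivative of the flux
    contradicts the positive slope of the bump ([no_edge_contact]). *)

(** * Maxima of semicontinuous functions on compact regions *)

Definition close3 (d x y t x' y' t' : R) : Prop :=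
  Rabs (x' - x) < d /\ Rabs (y' - y) < d /\ Rabs (t' - t) < d.

(** If no point of [K] realises the supremum [M], every point has a neighbourhood
    on which [f] stays below [M] by at least the radius of that neighbourhood;
    compactness of the box makes the radius uniform, so [M] could be lowered.
    The region [K] is cut out of a box so that one statement serves both the
    two-point maximum over [x <= y] and the search for a first bad time. *)
Lemma usc_bounded_attains_max (a b tau C : R) (K : R -> R -> R -> Prop)
  (f : R -> R -> R -> R)
  (K_box : forall x y t, K x y t -> a <= x <= b /\ a <= y <= b /\ 0 <= t <= tau)
  (K_closed : forall x y t, ~ K x y t -> exists d, 0 < d /\
     forall x' y' t', close3 d x y t x' y' t' -> ~ K x' y' t')
  (f_usc : forall x y t eps, K x y t -> 0 < eps -> exists d, 0 < d /\
     forall x' y' t', close3 d x y t x' y' t' -> K x' y' t' ->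
       f x' y' t' < f x y t + eps)
  (K_inh : exists x y t, K x y t)
  (f_bdd : forall x y t, K x y t -> f x y t <= C) :
  exists x y t, K x y t /\ forall x' y' t', K x' y' t' -> f x' y' t' <= f x y t.
Proof.
  apply NNPP; intros Hno.
  destruct (completeness (fun z => exists x y t, K x y t /\ z = f x y t))
    as [M [Mub Mlub]].
  { exists C; intros z (x & y & t & HK & ->); now apply f_bdd. }
  { destruct K_inh as (x & y & t & HK); now exists (f x y t), x, y, t. }
  assert (Hlt : forall x y t, K x y t -> f x y t < M).
  { intros x y t HK. destruct (Rlt_or_le (f x y t) M) as [H | H]; [exact H |].
    exfalso; apply Hno; exists x, y, t; split; [exact HK |].
    intros x' y' t' HK'. apply Rle_trans with M; [| exact H].
    apply Mub; now exists x', y', t'. }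
  assert (Hd : forall p : Compactness.Tn 3 R, exists d : posreal,
    forall x' y' t', close3 d (fst p) (fst (snd p)) (fst (snd (snd p))) x' y' t' ->
      K x' y' t' -> f x' y' t' <= M - d).
  { intros (x & y & t & []); simpl.
    destruct (classic (K x y t)) as [HK | HK].
    - pose proof (Hlt _ _ _ HK) as HM.
      destruct (f_usc x y t ((M - f x y t) / 2) HK) as (d & d0 & Hd); [lra |].
      assert (e0 : 0 < Rmin d ((M - f x y t) / 2)) by (apply Rmin_glb_lt; lra).
      exists (mkposreal _ e0); simpl; intros x' y' t' (H1 & H2 & H3) HK'.
      pose proof (Rmin_l d ((M - f x y t) / 2)).
      pose proof (Rmin_r d ((M - f x y t) / 2)).
      assert (f x' y' t' < f x y t + (M - f x y t) / 2); [| lra].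
      apply Hd; [repeat split; lra | exact HK'].
    - destruct (K_closed _ _ _ HK) as (d & d0 & Hd).
      exists (mkposreal _ d0); simpl; intros x' y' t' Hc HK'.
      destruct (Hd _ _ _ Hc HK'). }
  set (delta := fun p => proj1_sig (constructive_indefinite_description _ (Hd p))).
  assert (Hdelta : forall p x' y' t',
    close3 (delta p) (fst p) (fst (snd p)) (fst (snd (snd p))) x' y' t' ->
    K x' y' t' -> f x' y' t' <= M - delta p)
    by (intros p; exact (proj2_sig (constructive_indefinite_description _ (Hd p)))).
  clearbody delta.
  destruct (compactness_value 3 (a, (a, (0, tt))) (b, (b, (tau, tt))) delta)
    as [d Hcov].
  assert (M <= M - d); [| pose proof (cond_pos d); lra].
  apply Mlub; intros z (x & y & t & HK & ->).
  destruct (K_box _ _ _ HK) as (Hx & Hy & Ht).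
  apply NNPP; intros Hz.
  apply (Hcov (x, (y, (t, tt)))); [simpl; tauto |].
  intros ((x0 & y0 & t0 & []) & _ & Hc & Hle); apply Hz.
  apply Rle_trans with (M - delta (x0, (y0, (t0, tt))));
    [| apply Rplus_le_compat_l, Ropp_le_contravar; exact Hle].
  apply (Hdelta (x0, (y0, (t0, tt)))); [| exact HK]. simpl in Hc |- *; red; tauto.
Qed.

(** Composing with the bounded increasing function [atan] removes the upper bound. *)
Lemma usc_attains_max (a b tau : R) (K : R -> R -> R -> Prop)
  (f : R -> R -> R -> R)
  (K_box : forall x y t, K x y t -> a <= x <= b /\ a <= y <= b /\ 0 <= t <= tau)
  (K_closed : forall x y t, ~ K x y t -> exists d, 0 < d /\
     forall x' y' t', close3 d x y t x' y' t' -> ~ K x' y' t')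
  (f_usc : forall x y t eps, K x y t -> 0 < eps -> exists d, 0 < d /\
     forall x' y' t', close3 d x y t x' y' t' -> K x' y' t' ->
       f x' y' t' < f x y t + eps)
  (K_inh : exists x y t, K x y t) :
  exists x y t, K x y t /\ forall x' y' t', K x' y' t' -> f x' y' t' <= f x y t.
Proof.
  destruct (usc_bounded_attains_max a b tau (PI / 2) K (fun x y t => atan (f x y t)))
    as (x & y & t & HK & Hmax); auto.
  - intros x y t eps HK Heps.
    pose proof (derivable_continuous_pt atan (f x y t) (derivable_pt_atan _)) as Hc.
    destruct (Hc eps Heps) as (e & e0 & He).
    destruct (f_usc x y t e HK e0) as (d & d0 & Hd).
    exists d; split; [exact d0 |]; intros x' y' t' Hcl HK'.
    pose proof (Hd _ _ _ Hcl HK') as Hf.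
    destruct (Rle_lt_dec (f x' y' t') (f x y t)) as [Hle | Hlt].
    + assert (atan (f x' y' t') <= atan (f x y t)); [| lra].
      destruct Hle as [Hl | ->]; [left; now apply atan_increasing | right; reflexivity].
    + assert (H : Rabs (atan (f x' y' t') - atan (f x y t)) < eps).
      { apply (He (f x' y' t')); split; [split; [exact I | lra] |].
        simpl; unfold Rdist; rewrite Rabs_right; lra. }
      apply Rabs_def2 in H; lra.
  - intros x y t _; left; apply atan_bound.
  - exists x, y, t; split; [exact HK |]; intros x' y' t' HK'.
    destruct (Rle_lt_dec (f x' y' t') (f x y t)) as [Hle | Hlt]; [exact Hle |].
    pose proof (Hmax _ _ _ HK'); pose proof (atan_increasing _ _ Hlt); lra.
Qed.

(** * The profile of the travelling bump *)

Lemma mean_value_open (f df : R -> R) (a b : R) (ab : a < b)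
  (f_der : forall x, a < x < b -> is_derive f x (df x))
  (f_cont : forall x, a <= x <= b -> continuity_pt f x) :
  exists c, a < c < b /\ f b - f a = df c * (b - a).
Proof.
  destruct (MVT f id a b
    (fun c Hc => ex_derive_Reals_0 f c (ex_intro _ _ (f_der c Hc)))
    (fun c _ => derivable_pt_id c) ab f_cont) as (c & Hc & H).
  { intros c _; apply derivable_continuous_pt, derivable_pt_id. }
  exists c; split; [exact Hc |].
  rewrite (derive_pt_eq_0 f c (df c)) in H by now apply is_derive_Reals, f_der.
  rewrite derive_pt_id in H; unfold id in H; lra.
Qed.

Lemma is_derive_continuity_pt (f : R -> R) (x l : R) :
  is_derive f x l -> continuity_pt f x.
Proof.
  intros H; apply derivable_continuous_pt; exists l; now apply is_derive_Reals.
Qed.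

(** In the variable [q = sqrt x] the slope of the profile is
    [(1 - q) * (q + /400) / 16]. It is positive at the edge [x = 0] and vanishes
    at [x = 1], where two mirror copies of the profile are glued. The half-power
    of [x] lets the second derivative blow up at the edge, which is what a
    degenerate subsolution with a positive edge slope needs. The constants [/16]
    and [/400] are small enough for [barrier_margin_increasing]. *)
Definition quadratic_factor (q : R) : R := /400 + 133/200 * q - q^2 / 2.
Definition profile (x : R) : R := x * quadratic_factor (sqrt x) / 16.
Definition profile_slope (x : R) : R := (1 - sqrt x) * (sqrt x + /400) / 16.

Lemma quadratic_factor_ge (q : R) : 0 <= q <= 1 -> /400 <= quadratic_factor q.
Proof. intros H; unfold quadratic_factor; nra. Qed.

Lemma sqrt_unit (x : R) : 0 <= x <= 1 -> 0 <= sqrt x <= 1.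
Proof.
  intros H; split; [apply sqrt_pos |].
  rewrite <- sqrt_1; apply sqrt_le_1_alt; lra.
Qed.

Lemma profile_0 : profile 0 = 0.
Proof. unfold profile; lra. Qed.

Lemma is_derive_profile (x : R) : 0 < x -> is_derive profile x (profile_slope x).
Proof.
  intros Hx; unfold profile, profile_slope, quadratic_factor.
  auto_derive; [tauto |].
  assert (s0 : 0 < sqrt x) by now apply sqrt_lt_R0.
  assert (ss : sqrt x * sqrt x = x) by (apply sqrt_sqrt; lra).
  revert s0 ss; generalize (sqrt x); intros s s0 <-; field; lra.
Qed.

Lemma profile_continuous (x : R) : continuity_pt profile x.
Proof.
  assert (Hs : continuity_pt sqrt x)
    by apply continuity_pt_filterlim, continuous_sqrt.
  assert (HY : continuity_pt quadratic_factor (sqrt x)).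
  { apply derivable_continuous_pt; unfold quadratic_factor; reg. }
  apply continuity_pt_mult; [| apply continuity_pt_const; now intros ? ?].
  apply continuity_pt_mult; [apply derivable_continuous_pt, derivable_pt_id |].
  now apply (continuity_pt_comp sqrt).
Qed.

Lemma profile_slope_bounds (x : R) :
  0 <= x <= 1 -> 0 <= profile_slope x <= 1.
Proof.
  intros Hx; pose proof (sqrt_unit x Hx); unfold profile_slope; nra.
Qed.

Lemma profile_increment (x y : R) : 0 <= x -> x <= y -> y <= 1 ->
  0 <= profile y - profile x <= y - x.
Proof.
  intros Hx [Hxy | ->] Hy; [| lra].
  destruct (mean_value_open profile profile_slope x y Hxy) as (c & Hc & ->).
  - intros z Hz; apply is_derive_profile; lra.
  - intros; apply profile_continuous.
  - pose proof (profile_slope_bounds c ltac:(lra)); nra.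
Qed.

Lemma profile_ge (x : R) : 0 <= x <= 1 -> x / 6400 <= profile x.
Proof.
  intros Hx; pose proof (quadratic_factor_ge _ (sqrt_unit x Hx)).
  unfold profile; nra.
Qed.

(** [profile_slope x + x - 2 * sqrt (profile x)] in the variable [q = sqrt x],
    where it is differentiable up to the edge. *)
Definition barrier_margin (q : R) : R :=
  (1 - q) * (q + /400) / 16 + q ^ 2 - q * sqrt (quadratic_factor q) / 2.

(** The derivative has the sign of [s * A - 4 * Z], with [s ^ 2] the quadratic
    factor. After squaring, what is left is a positive quartic on the unit
    interval. *)
Lemma barrier_margin_increasing (p q : R) :
  0 <= p -> p < q -> q <= 1 -> barrier_margin p < barrier_margin q.
Proof.
  intros Hp Hpq Hq.
  set (d := fun q => (399/400 - 2 * q) / 16 + 2 * q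
    - sqrt (quadratic_factor q) / 2
    - q * (133/200 - q) / (4 * sqrt (quadratic_factor q))).
  assert (Hder : forall z, 0 <= z <= 1 -> is_derive barrier_margin z (d z)).
  { intros z Hz; pose proof (quadratic_factor_ge z Hz) as HY.
    assert (s0 : 0 < sqrt (quadratic_factor z)) by (apply sqrt_lt_R0; lra).
    unfold barrier_margin, d, quadratic_factor in *; auto_derive; [lra |].
    replace (/ 400 + 133 / 200 * z + - (z * (z * 1) * / 2))
      with (/ 400 + 133 / 200 * z - z ^ 2 / 2) by field.
    field; lra. }
  destruct (mean_value_open barrier_margin d p q Hpq) as (z & Hz & H).
  { intros z Hz; apply Hder; lra. }
  { intros z Hz; apply is_derive_continuity_pt with (d z), Hder; lra. }
  cut (0 < d z); [intros; nra |].
  pose proof (quadratic_factor_ge z ltac:(lra)) as HY.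
  assert (s0 : 0 < sqrt (quadratic_factor z)) by (apply sqrt_lt_R0; lra).
  assert (ss : sqrt (quadratic_factor z) * sqrt (quadratic_factor z)
    = quadratic_factor z) by (apply sqrt_sqrt; lra).
  set (s := sqrt (quadratic_factor z)) in *.
  set (A := 399/800 + 15 * z). set (Z := (1 - z) * (z + /400)).
  assert (HAZ : 4 * Z < s * A).
  { apply Rsqr_incrst_0; unfold Rsqr; [| unfold Z; nra | unfold A; nra].
    replace (s * A * (s * A)) with (quadratic_factor z * (A * A))
      by (rewrite <- ss; ring).
    (* The quartic minus [z] times this cubic has positive coefficients. *)
    assert (z2 : 0 <= z^2) by nra. assert (z3 : 0 <= z^3) by nra.
    assert (z4 : 0 <= z^4) by nra.
    assert (H1 : 0 <= 48/100000 - 214/10000 * z + 679/1000 * z^2 - 503/1000 * z^3).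
    { destruct (Rle_lt_dec z (1/2)) as [Hz2 | Hz2].
      - apply Rle_trans with (48/100000 - 214/10000 * z + 427/1000 * z^2); [nra |].
        assert (0 <= (1/2 - z) * z^2) by (apply Rmult_le_pos; lra). nra.
      - assert (0 <= (1 - z) * z^2) by (apply Rmult_le_pos; lra). nra. }
    assert (H2 : 0 <= z * (48/100000 - 214/10000 * z + 679/1000 * z^2 - 503/1000 * z^3))
      by (apply Rmult_le_pos; lra).
    unfold A, Z, quadratic_factor; lra. }
  replace (d z) with ((s * A - 4 * Z) / (8 * s)).
  { apply Rdiv_lt_0_compat; lra. }
  unfold d; fold s; unfold A, Z.
  field_simplify; [| lra | lra].
  replace (s ^ 2) with (quadratic_factor z) by (rewrite <- ss; ring).
  unfold quadratic_factor; field; lra.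
Qed.

(** This is the integrated form of the travelling wave inequality
    [f' / sqrt f < f'' + 1] for the profile [f]. The terms are, in
    order, diffusion, the source [g 1 / r ^ 2] created by the radial term, and
    transport at the speed of the wave; only increments are compared, so that
    neither the edge nor the centre needs a second derivative. *)
Lemma profile_subsolution (x y : R) : 0 <= x -> x < y -> y <= 1 ->
  profile_slope x + x - 2 * sqrt (profile x)
  < profile_slope y + y - 2 * sqrt (profile y).
Proof.
  assert (E : forall z, 0 <= z <= 1 ->
    profile_slope z + z - 2 * sqrt (profile z) = barrier_margin (sqrt z)).
  { intros z Hz; pose proof (quadratic_factor_ge _ (sqrt_unit z Hz)) as HY.
    unfold profile_slope, profile, barrier_margin.
    replace (z * quadratic_factor (sqrt z) / 16)
      with (z * quadratic_factor (sqrt z) * (/4 * /4)) by field.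
    rewrite (sqrt_mult (z * quadratic_factor (sqrt z))), sqrt_mult,
      sqrt_square by nra.
    replace (sqrt z ^ 2) with z by (simpl; rewrite Rmult_1_r, sqrt_sqrt; lra).
    field. }
  intros Hx Hxy Hy; rewrite !E by lra.
  apply barrier_margin_increasing.
  - apply sqrt_pos.
  - apply sqrt_lt_1; lra.
  - apply sqrt_unit; lra.
Qed.

(** * Contact points, and solutions in a moving frame *)

Lemma is_derive_pos_strict (f : R -> R) (x l : R) : is_derive f x l -> 0 < l ->
  exists d, 0 < d /\ forall h, 0 < h < d -> f (x - h) < f x < f (x + h).
Proof.
  intros Hf Hl; apply is_derive_Reals in Hf.
  destruct (Hf l Hl) as [d Hd]; exists d; split; [apply cond_pos |]; intros h Hh.
  pose proof (Hd h ltac:(lra) ltac:(rewrite Rabs_right; lra)) as H1.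
  pose proof (Hd (- h) ltac:(lra) ltac:(rewrite Rabs_left; lra)) as H2.
  apply Rabs_def2 in H1; apply Rabs_def2 in H2.
  assert (E1 : f (x + h) - f x = (f (x + h) - f x) / h * h) by (field; lra).
  assert (E2 : f (x + - h) - f x = - ((f (x + - h) - f x) / - h) * h) by (field; lra).
  unfold Rminus at 1; split; nra.
Qed.

Lemma is_derive_neg_strict (f : R -> R) (x l : R) : is_derive f x l -> l < 0 ->
  exists d, 0 < d /\ forall h, 0 < h < d -> f (x + h) < f x < f (x - h).
Proof.
  intros Hf Hl.
  destruct (is_derive_pos_strict (fun z => - f z) x (- l)) as (d & d0 & Hd).
  - now apply (is_derive_opp (K := R_AbsRing) (V := R_NormedModule)).
  - lra.
  - exists d; split; [exact d0 |]; intros h Hh; specialize (Hd h Hh); lra.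
Qed.

Lemma is_derive_sub (f h : R -> R) (x l m : R) :
  is_derive f x l -> is_derive h x m -> is_derive (fun z => f z - h z) x (l - m).
Proof. apply (is_derive_minus (K := R_AbsRing) (V := R_NormedModule)). Qed.

Lemma is_derive_local_max (f : R -> R) (x l d : R) : is_derive f x l -> 0 < d ->
  (forall h, Rabs h < d -> f (x + h) <= f x) -> l = 0.
Proof.
  intros Hf Hd Hmax; destruct (Rtotal_order l 0) as [Hl | [Hl | Hl]]; [| exact Hl |];
    exfalso.
  - destruct (is_derive_neg_strict _ _ _ Hf Hl) as (e & e0 & He).
    assert (m0 : 0 < Rmin d e) by now apply Rmin_glb_lt.
    pose proof (Rmin_l d e); pose proof (Rmin_r d e).
    pose proof (He (Rmin d e / 2) ltac:(lra)).
    pose proof (Hmax (- (Rmin d e / 2)) ltac:(rewrite Rabs_left; lra)).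
    unfold Rminus in *; lra.
  - destruct (is_derive_pos_strict _ _ _ Hf Hl) as (e & e0 & He).
    assert (m0 : 0 < Rmin d e) by now apply Rmin_glb_lt.
    pose proof (Rmin_l d e); pose proof (Rmin_r d e).
    pose proof (He (Rmin d e / 2) ltac:(lra)).
    pose proof (Hmax (Rmin d e / 2) ltac:(rewrite Rabs_right; lra)); lra.
Qed.

Definition increasing_on_unit (g : R -> R) : Prop :=
  forall a b, -1 <= a -> a < b -> b <= 1 -> g a < g b.

(** At a maximum of [U - psi] the slopes agree, and the flux of [U] cannot grow
    faster than that of [psi]: otherwise [g (V z) > g (B z)] just to the right,
    hence [V z > B z] there since [g] is increasing, and [U - psi] would grow.
    At the edge [y = l] the maximum is one-sided and only gives [1 = B y <= V y],
    so [V y = 1]; there the flux has a local maximum and its derivative is [0]. *)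
Lemma contact (g U V psi B : R -> R) (P a y l L : R)
  (g_incr : increasing_on_unit g)
  (ay : a < y) (yl : y <= l)
  (U_der : forall z, a <= z <= l -> is_derive U z (V z))
  (psi_der : forall z, a <= z <= l -> is_derive psi z (B z))
  (V_unit : forall z, a <= z <= l -> -1 <= V z <= 1)
  (B_unit : forall z, a <= z <= l -> -1 <= B z <= 1)
  (B_edge : B l = 1)
  (gB_der : y < l -> is_derive (fun z => g (B z)) y P)
  (P_edge : y = l -> 0 <= P)
  (gV_der : is_derive (fun z => g (V z)) y L)
  (gV_edge : V y = 1 -> exists d, 0 < d /\
     forall h, Rabs h < d -> g (V (y + h)) <= g (V y))
  (y_max : forall z, a <= z <= l -> U z - psi z <= U y - psi y) :
  V y = B y /\ L <= P.
Proof.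
  assert (D : forall z, a <= z <= l ->
    is_derive (fun z => U z - psi z) z (V z - B z)).
  { intros z Hz; apply is_derive_sub; auto. }
  assert (Hge : B y <= V y).
  { destruct (Rle_lt_dec (B y) (V y)) as [H | H]; [exact H | exfalso].
    destruct (is_derive_neg_strict _ _ _ (D y ltac:(lra))) as (d & d0 & Hd); [lra |].
    assert (m0 : 0 < Rmin d (y - a)) by (apply Rmin_glb_lt; lra).
    pose proof (Rmin_l d (y - a)); pose proof (Rmin_r d (y - a)).
    pose proof (Hd (Rmin d (y - a) / 2) ltac:(lra)).
    pose proof (y_max (y - Rmin d (y - a) / 2) ltac:(lra)); lra. }
  destruct yl as [yl | ->].
  2:{ pose proof (V_unit l ltac:(lra)).
      assert (V1 : V l = 1) by lra; split; [lra |].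
      destruct (gV_edge V1) as (d & d0 & Hd).
      rewrite (is_derive_local_max _ _ _ _ gV_der d0 Hd); auto. }
  assert (Hle : V y <= B y).
  { destruct (Rle_lt_dec (V y) (B y)) as [H | H]; [exact H | exfalso].
    destruct (is_derive_pos_strict _ _ _ (D y ltac:(lra))) as (d & d0 & Hd); [lra |].
    assert (m0 : 0 < Rmin d (l - y)) by (apply Rmin_glb_lt; lra).
    pose proof (Rmin_l d (l - y)); pose proof (Rmin_r d (l - y)).
    pose proof (Hd (Rmin d (l - y) / 2) ltac:(lra)).
    pose proof (y_max (y + Rmin d (l - y) / 2) ltac:(lra)); lra. }
  assert (E : V y = B y) by lra; split; [exact E |].
  destruct (Rle_lt_dec L P) as [H | H]; [exact H | exfalso].
  destruct (is_derive_pos_strict _ _ _ (is_derive_sub _ _ _ _ _ gV_der (gB_der yl)))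
    as (d & d0 & Hd); [lra |].
  assert (m0 : 0 < Rmin d (l - y)) by (apply Rmin_glb_lt; lra).
  pose proof (Rmin_l d (l - y)); pose proof (Rmin_r d (l - y)).
  set (e := Rmin d (l - y) / 2) in *.
  destruct (mean_value_open (fun z => U z - psi z) (fun z => V z - B z) y (y + e))
    as (z & Hz & Hdiff).
  { unfold e; lra. }
  { intros z Hz; apply D; unfold e in Hz; lra. }
  { intros z Hz; apply is_derive_continuity_pt with (V z - B z), D;
      unfold e in Hz; lra. }
  pose proof (y_max (y + e) ltac:(unfold e; lra)) as Hmax.
  pose proof (Hd (z - y) ltac:(unfold e in Hz; lra)) as Hz'.
  replace (y + (z - y)) with z in Hz' by ring; rewrite E in Hz'.
  assert (B z < V z); [| nra].
  destruct (Rlt_le_dec (B z) (V z)) as [Hlt | Hge']; [exact Hlt | exfalso].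
  assert (Hzl : a <= z <= l) by (unfold e in Hz; lra).
  destruct Hge' as [Hlt | Heq].
  - pose proof (g_incr _ _ (proj1 (V_unit z Hzl)) Hlt (proj2 (B_unit z Hzl))); lra.
  - rewrite Heq in Hz'; lra.
Qed.

Definition jointly_continuous (r1 r2 T : R) (w : R -> R -> R) : Prop :=
  forall r t eps, cylinder r1 r2 T (r, t) -> 0 < eps -> exists d, 0 < d /\
    forall r' t', Rabs (r' - r) < d -> Rabs (t' - t) < d ->
      cylinder r1 r2 T (r', t') -> Rabs (w r' t' - w r t) < eps.

Lemma continuous_on_cylinder (r1 r2 T : R) (w : R -> R -> R) :
  continuous_on (cylinder r1 r2 T) (fun p => w (fst p) (snd p)) ->
  jointly_continuous r1 r2 T w.
Proof.
  intros H r t eps Hc Heps.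
  destruct (H (r, t) Hc (fun z => Rabs (z - w r t) < eps)) as [d Hd].
  { exists (mkposreal eps Heps); intros z Hz; exact Hz. }
  exists d; split; [apply cond_pos |]; intros r' t' H1 H2 H3.
  apply (Hd (r', t')); [split; assumption | exact H3].
Qed.

(** The part of the problem that the maximum principle uses, with [g] the flux
    function and [v] the radial derivative. This form is stable under
    [u |-> - u], so upper bounds on [v] also give lower bounds. *)
Definition solves (g : R -> R) (r1 r2 T : R) (u v : R -> R -> R) : Prop :=
  (forall r t, cylinder r1 r2 T (r, t) -> is_derive (fun x => u x t) r (v r t)) /\
  jointly_continuous r1 r2 T u /\
  jointly_continuous r1 r2 T v /\
  forall r t, cylinder r1 r2 T (r, t) -> 0 < t -> exists l,
    is_derive (fun x => g (v x t)) r l /\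
    is_derive (fun s => u r s) t (l + g (v r t) / r).

Lemma solves_opp (g : R -> R) (r1 r2 T : R) (u v : R -> R -> R)
  (g_odd : forall x, g (- x) = - g x) :
  solves g r1 r2 T u v ->
  solves g r1 r2 T (fun r t => - u r t) (fun r t => - v r t).
Proof.
  assert (Hopp : forall w, jointly_continuous r1 r2 T w ->
    jointly_continuous r1 r2 T (fun r t => - w r t)).
  { intros w Hw r t eps Hc He; destruct (Hw r t eps Hc He) as (d & d0 & Hd).
    exists d; split; [exact d0 |]; intros r' t' H1 H2 H3.
    replace (- w r' t' - - w r t) with (- (w r' t' - w r t)) by ring.
    rewrite Rabs_Ropp; auto. }
  intros (Hr & Hu & Hv & Ht).
  refine (conj _ (conj (Hopp _ Hu) (conj (Hopp _ Hv) _))).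
  - intros r t Hc; now apply (is_derive_opp (fun x => u x t)), Hr.
  - intros r t Hc t0; destruct (Ht r t Hc t0) as (l & Hl & Hd); exists (- l); split.
    + apply is_derive_ext with (fun x => - g (v x t)).
      { intros x; now rewrite g_odd. }
      now apply (is_derive_opp (fun x => g (v x t))).
    + rewrite g_odd.
      replace (- l + - g (v r t) / r) with (- (l + g (v r t) / r))
        by (unfold Rdiv; ring).
      now apply (is_derive_opp (fun s => u r s)).
Qed.

Lemma moving_continuous (r1 r2 T : R) (w : R -> R -> R) (rho kappa xi t eps : R) :
  jointly_continuous r1 r2 T w ->
  cylinder r1 r2 T (rho + kappa * t + xi, t) -> 0 < eps ->
  exists d, 0 < d /\ forall xi' t', Rabs (xi' - xi) < d -> Rabs (t' - t) < d ->
    cylinder r1 r2 T (rho + kappa * t' + xi', t') ->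
    Rabs (w (rho + kappa * t' + xi') t' - w (rho + kappa * t + xi) t) < eps.
Proof.
  intros Hw Hc He; destruct (Hw _ _ _ Hc He) as (d & d0 & Hd).
  pose proof (Rabs_pos kappa).
  assert (e0 : 0 < d / (Rabs kappa + 1)) by (apply Rdiv_lt_0_compat; lra).
  assert (ed : Rabs kappa * (d / (Rabs kappa + 1)) + d / (Rabs kappa + 1) = d)
    by (field; lra).
  exists (d / (Rabs kappa + 1)); split; [exact e0 |]; intros xi' t' Hx Ht Hc'.
  apply Hd; [| nra | exact Hc'].
  replace (rho + kappa * t' + xi' - (rho + kappa * t + xi))
    with (kappa * (t' - t) + (xi' - xi)) by ring.
  apply Rle_lt_trans with (1 := Rabs_triang _ _); rewrite Rabs_mult.
  pose proof (Rmult_le_compat_l _ _ _ H (Rlt_le _ _ Ht)); lra.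
Qed.

(** The chain rule along an oblique line. The mean value theorem in [r] and the
    joint continuity of [v] replace the continuity of the time derivative. *)
Lemma is_derive_moving (g : R -> R) (r1 r2 T : R) (u v : R -> R -> R)
  (rho kappa t l : R) :
  solves g r1 r2 T u v -> cylinder r1 r2 T (rho + kappa * t, t) -> 0 < t ->
  is_derive (fun s => u (rho + kappa * t) s) t l ->
  is_derive (fun s => u (rho + kappa * s) s) t (l + kappa * v (rho + kappa * t) t).
Proof.
  intros (Hr & _ & Hv & _) Hc t0 Hl; apply is_derive_Reals in Hl.
  apply is_derive_Reals; intros eps Heps.
  destruct (Hl (eps / 2)) as [d1 H1]; [lra |].
  pose proof (Rabs_pos kappa) as k0.
  assert (e0 : 0 < eps / (2 * (Rabs kappa + 1))) by (apply Rdiv_lt_0_compat; lra).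
  destruct (Hv _ _ _ Hc e0) as (d2 & d20 & H2).
  set (r := rho + kappa * t) in *.
  destruct Hc as [[Hc1 Hc2] [Hc3 Hc4]]; simpl in Hc1, Hc2, Hc3, Hc4.
  set (m := Rmin d2 (Rmin (r - r1) (r2 - r))).
  assert (m0 : 0 < m) by (repeat apply Rmin_glb_lt; lra).
  assert (md2 : m <= d2) by apply Rmin_l.
  assert (m12 : m <= Rmin (r - r1) (r2 - r)) by apply Rmin_r.
  pose proof (Rmin_l (r - r1) (r2 - r)). pose proof (Rmin_r (r - r1) (r2 - r)).
  set (e := m / (Rabs kappa + 1)).
  assert (ee : 0 < e) by (apply Rdiv_lt_0_compat; lra).
  assert (em : Rabs kappa * e + e = m) by (unfold e; field; lra).
  assert (n0 : 0 < Rmin (Rmin d1 e) (Rmin t (T - t))).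
  { repeat apply Rmin_glb_lt; try apply cond_pos; lra. }
  exists (mkposreal _ n0); simpl; intros h h0 Hh.
  pose proof (Rmin_l (Rmin d1 e) (Rmin t (T - t))).
  pose proof (Rmin_r (Rmin d1 e) (Rmin t (T - t))).
  pose proof (Rmin_l d1 e). pose proof (Rmin_r d1 e).
  pose proof (Rmin_l t (T - t)). pose proof (Rmin_r t (T - t)).
  pose proof (H1 h h0 ltac:(lra)) as Hu.
  assert (Hh2 : - e < h < e) by (apply Rabs_def2 in Hh; lra).
  assert (Hht : - t < h < T - t) by (apply Rabs_def2 in Hh; lra).
  assert (Hkh : Rabs (kappa * h) < m).
  { rewrite Rabs_mult.
    pose proof (Rmult_le_compat_l _ (Rabs h) e k0 ltac:(lra)); lra. }
  assert (Hnear : forall z, Rmin r (r + kappa * h) <= z <= Rmax r (r + kappa * h) ->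
    Rabs (z - r) <= Rabs (kappa * h)).
  { intros z; unfold Rmin, Rmax; destruct (Rle_dec r (r + kappa * h)); intros Hz;
      [rewrite !Rabs_right | rewrite !Rabs_left1]; lra. }
  assert (Hcyl : forall z, Rmin r (r + kappa * h) <= z <= Rmax r (r + kappa * h) ->
    cylinder r1 r2 T (z, t + h)).
  { intros z Hz; apply Hnear in Hz.
    assert (Rabs (z - r) < m) as Hzm by lra; apply Rabs_def2 in Hzm.
    split; simpl; lra. }
  destruct (MVT_gen (fun x => u x (t + h)) r (r + kappa * h) (fun x => v x (t + h)))
    as (z & Hz & Hmv).
  { intros z Hz; apply Hr, Hcyl; lra. }
  { intros z Hz; apply is_derive_continuity_pt with (v z (t + h)).
    apply Hr, Hcyl, Hz. }
  assert (Hvz : Rabs (v z (t + h) - v r t) < eps / (2 * (Rabs kappa + 1))).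
  { apply H2; [| | now apply Hcyl].
    - apply Rle_lt_trans with (1 := Hnear z Hz); lra.
    - replace (t + h - t) with h by ring.
      assert (e <= m) by (pose proof (Rmult_le_pos _ _ k0 (Rlt_le _ _ ee)); lra); lra. }
  replace (rho + kappa * (t + h)) with (r + kappa * h) by (unfold r; ring).
  fold r.
  replace ((u (r + kappa * h) (t + h) - u r t) / h - (l + kappa * v r t))
    with (((u r (t + h) - u r t) / h - l) + kappa * (v z (t + h) - v r t)).
  2:{ replace (u (r + kappa * h) (t + h))
        with (u r (t + h) + v z (t + h) * (r + kappa * h - r)) by lra.
      field; exact h0. }
  apply Rle_lt_trans with (1 := Rabs_triang _ _); rewrite Rabs_mult.
  pose proof (Rmult_le_compat_l _ _ _ k0 (Rlt_le _ _ Hvz)) as Hk.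
  assert (Rabs kappa * (eps / (2 * (Rabs kappa + 1))) < eps / 2); [| lra].
  assert (E : Rabs kappa * (eps / (2 * (Rabs kappa + 1)))
    + eps / (2 * (Rabs kappa + 1)) = eps / 2) by (field; lra).
  lra.
Qed.

(** * Two-point comparison with a barrier *)

(** A stationary barrier for [v] in a tube of half-width [l] that moves with speed
    [kappa]; [P] is the derivative of the flux [g (B x)], with one-sided values
    at the edges. If a solution had slope [B] and flux derivative [P], then
    [P x + g (B x) / (rho + x) + kappa * B x] would be its time derivative in the
    moving frame; that this quantity decreases in [x] makes [B] a strict
    supersolution, in a form that involves no second derivative of [B]. The
    edge angle is what forbids a solution to reach [1] at the edge. *)
Record barrier (g : R -> R) (r1 r2 kappa l b0 : R) (B P : R -> R) : Prop := {
  barrier_continuous : forall x, continuous B x;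
  barrier_range : forall x, b0 <= B x <= 1;
  barrier_left : B (- l) = 1;
  barrier_right : B l = 1;
  barrier_flux : forall x, - l < x < l -> is_derive (fun z => g (B z)) x (P x);
  barrier_slope_left : P (- l) <= 0;
  barrier_slope_right : 0 <= P l;
  barrier_speed_decreasing : forall rho x y,
    r1 <= rho - l -> rho + l <= r2 -> - l <= x -> x < y -> y <= l ->
    P y + g (B y) / (rho + y) + kappa * B y < P x + g (B x) / (rho + x) + kappa * B x;
  barrier_edge_angle : exists beta, 0 < beta /\ forall x, - l <= x <= l ->
    g (B x) <= g 1 - beta * (l - Rabs x)
}.

(** Where the slope is [1] the flux [g v] is at its largest possible value for
    nearby positive slopes, on both sides of the critical value. *)
Lemma flux_local_max (g : R -> R) (r1 r2 T : R) (u v : R -> R -> R) (r t : R)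
  (sol : solves g r1 r2 T u v) (g_max : forall s, 0 <= s -> g s <= g 1)
  (in_cyl : cylinder r1 r2 T (r, t)) (v1 : v r t = 1) :
  exists d, 0 < d /\ forall h, Rabs h < d -> g (v (r + h) t) <= g (v r t).
Proof.
  destruct sol as (_ & _ & Hv & _).
  destruct (Hv r t 1 in_cyl Rlt_0_1) as (d & d0 & Hd).
  destruct in_cyl as [[Hr1 Hr2] Ht]; simpl in Hr1, Hr2, Ht.
  assert (m0 : 0 < Rmin d (Rmin (r - r1) (r2 - r))) by (repeat apply Rmin_glb_lt; lra).
  pose proof (Rmin_l d (Rmin (r - r1) (r2 - r))).
  pose proof (Rmin_r d (Rmin (r - r1) (r2 - r))).
  pose proof (Rmin_l (r - r1) (r2 - r)). pose proof (Rmin_r (r - r1) (r2 - r)).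
  exists (Rmin d (Rmin (r - r1) (r2 - r))); split; [exact m0 |]; intros h Hh.
  assert (Hh' := Rabs_def2 _ _ Hh).
  rewrite v1; apply g_max.
  pose proof (Hd (r + h) t) as Hv'; rewrite v1 in Hv'.
  replace (r + h - r) with h in Hv' by ring.
  rewrite Rminus_diag, Rabs_R0 in Hv'.
  assert (Habs : Rabs (v (r + h) t - 1) < 1).
  { apply Hv'; [lra | lra | split; simpl; lra]. }
  apply Rabs_def2 in Habs; lra.
Qed.

Lemma is_derive_left_max (f : R -> R) (t l : R) : 0 < t -> is_derive f t l ->
  (forall s, 0 <= s <= t -> f s <= f t) -> 0 <= l.
Proof.
  intros t0 Hf Hmax; destruct (Rle_lt_dec 0 l) as [H | H]; [exact H | exfalso].
  destruct (is_derive_neg_strict _ _ _ Hf H) as (d & d0 & Hd).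
  assert (m0 : 0 < Rmin d t) by now apply Rmin_glb_lt.
  pose proof (Rmin_l d t). pose proof (Rmin_r d t).
  pose proof (Hd (Rmin d t / 2) ltac:(lra)).
  pose proof (Hmax (t - Rmin d t / 2) ltac:(lra)); lra.
Qed.

Lemma is_derive_shift (f : R -> R) (c x l : R) :
  is_derive f (c + x) l -> is_derive (fun z => f (c + z)) x l.
Proof.
  intros H; replace l with (scal 1 l) by (unfold scal; simpl; unfold mult; simpl; ring).
  apply (is_derive_comp f (fun z => c + z)); [exact H |].
  auto_derive; [exact I | ring].
Qed.

Lemma is_derive_reflect (f : R -> R) (x l : R) :
  is_derive f (- x) l -> is_derive (fun z => - f (- z)) x l.
Proof.
  intros H; replace l with (opp (scal (- 1) l))
    by (unfold opp, scal; simpl; unfold mult; simpl; ring).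
  apply (is_derive_opp (fun z => f (- z))).
  apply (is_derive_comp f (fun z => - z)); [exact H |].
  auto_derive; [exact I | ring].
Qed.

(** Two-point maximum principle. With [d = u - psi] and [psi' = B], the bound
    [v <= B] says that [d y t <= d x t] for [x <= y]. At a positive maximum of
    [d y t - d x t] one has [x < y] and [t > 0], and the two contact lemmas, at
    [y] and (after reflection) at [x], bound the time derivative of the difference
    by the increment between [x] and [y] of the strictly decreasing quantity of
    the barrier. It would then be negative, against maximality in time. Working
    with [u] rather than [v] avoids differentiating the equation, which [u] is
    not regular enough for. *)
Lemma comparison (g : R -> R) (r1 r2 T : R) (u v : R -> R -> R)
  (rho kappa l tau b0 : R) (B P : R -> R)
  (sol : solves g r1 r2 T u v)
  (g_incr : increasing_on_unit g)
  (g_max : forall s, 0 <= s -> g s <= g 1)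
  (l0 : 0 < l) (b0_pos : 0 <= b0)
  (bar : barrier g r1 r2 kappa l b0 B P)
  (tube : forall x t, - l <= x <= l -> 0 <= t <= tau ->
     cylinder r1 r2 T (rho + kappa * t + x, t))
  (unit : forall x t, - l <= x <= l -> 0 <= t <= tau ->
     -1 <= v (rho + kappa * t + x) t <= 1)
  (init : forall x, - l <= x <= l -> v (rho + x) 0 <= B x) :
  forall x t, - l <= x <= l -> 0 <= t <= tau -> v (rho + kappa * t + x) t <= B x.
Proof.
  set (psi := fun x => RInt B 0 x).
  assert (Hpsi : forall x, is_derive psi x (B x)).
  { intros x; apply (is_derive_RInt B psi 0); 
      [| apply (barrier_continuous _ _ _ _ _ _ _ _ bar)].
    apply filter_forall; intros z; apply (RInt_correct (V := R_CompleteNormedModule)).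
    apply (ex_RInt_continuous (V := R_CompleteNormedModule)).
    intros w _; apply (barrier_continuous _ _ _ _ _ _ _ _ bar). }
  pose proof sol as (Hr & Hu & Hv & Ht).
  set (d := fun x t => u (rho + kappa * t + x) t - psi x).
  assert (Ud : forall x t, - l <= x <= l -> 0 <= t <= tau ->
    is_derive (fun z => u (rho + kappa * t + z) t) x (v (rho + kappa * t + x) t)).
  { intros x t Hx Htt; apply (is_derive_shift (fun z => u z t)), Hr, tube; assumption. }
  assert (Dd : forall x t, - l <= x <= l -> 0 <= t <= tau ->
    is_derive (fun z => d z t) x (v (rho + kappa * t + x) t - B x)).
  { intros x t Hx Htt; apply (is_derive_sub (fun z => u (rho + kappa * t + z) t));
      [now apply Ud | apply Hpsi]. }
  cut (forall x y t, - l <= x -> x <= y -> y <= l -> 0 <= t <= tau -> d y t <= d x t).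
  { intros Hmono x t Hx Htt.
    destruct (Rle_lt_dec (v (rho + kappa * t + x) t) (B x)) as [H | H]; [exact H |].
    exfalso.
    destruct (is_derive_pos_strict _ _ _ (Dd x t Hx Htt)) as (e & e0 & He); [lra |].
    destruct (Rle_lt_dec 0 x) as [Hx0 | Hx0].
    - assert (m0 : 0 < Rmin e l) by now apply Rmin_glb_lt.
      pose proof (Rmin_l e l). pose proof (Rmin_r e l).
      pose proof (He (Rmin e l / 2) ltac:(lra)).
      pose proof (Hmono (x - Rmin e l / 2) x t ltac:(lra) ltac:(lra) ltac:(lra) Htt); lra.
    - assert (m0 : 0 < Rmin e l) by now apply Rmin_glb_lt.
      pose proof (Rmin_l e l). pose proof (Rmin_r e l).
      pose proof (He (Rmin e l / 2) ltac:(lra)).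
      pose proof (Hmono x (x + Rmin e l / 2) t ltac:(lra) ltac:(lra) ltac:(lra) Htt); lra. }
  intros xx yy tt Hxx Hxy Hyy Htt.
  set (K := fun x y t => - l <= x /\ x <= y /\ y <= l /\ 0 <= t <= tau).
  assert (Dcont : forall x t eps, - l <= x <= l -> 0 <= t <= tau -> 0 < eps ->
    exists e, 0 < e /\ forall x' t', Rabs (x' - x) < e -> Rabs (t' - t) < e ->
      - l <= x' <= l -> 0 <= t' <= tau -> Rabs (d x' t' - d x t) < eps).
  { intros x t eps Hx Ht0 Heps.
    destruct (moving_continuous r1 r2 T u rho kappa x t (eps / 2) Hu (tube x t Hx Ht0))
      as (e & e0 & He); [lra |].
    destruct (is_derive_continuity_pt psi x (B x) (Hpsi x) (eps / 2)) as (e' & e'0 & He').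
    { lra. }
    exists (Rmin e e'); split; [now apply Rmin_glb_lt |]; intros x' t' H1 H2 H3 H4.
    pose proof (Rmin_l e e'). pose proof (Rmin_r e e').
    pose proof (He x' t' ltac:(lra) ltac:(lra) (tube x' t' H3 H4)) as Hux.
    assert (Hpx : Rabs (psi x' - psi x) < eps / 2).
    { destruct (Req_dec x' x) as [-> | Hne].
      - rewrite Rminus_diag, Rabs_R0; lra.
      - apply (He' x'); split; [split; [exact I | congruence] |].
        simpl; unfold Rdist; lra. }
    unfold d; apply Rabs_def2 in Hux; apply Rabs_def2 in Hpx; apply Rabs_def1; lra. }
  destruct (usc_attains_max (- l) l tau K (fun x y t => d y t - d x t))
    as (x & y & t & (Hx & Hxy0 & Hy & Ht0) & Hmax).
  { unfold K; intros; lra. }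
  { intros x y t HK.
    assert (Hcase : x < - l \/ y < x \/ l < y \/ t < 0 \/ tau < t).
    { apply NNPP; intros Hn; apply HK; unfold K; lra. }
    assert (He : exists e, 0 < e /\ (x + e <= - l \/ y + 2 * e <= x \/ l + e <= y
      \/ t + e <= 0 \/ tau + e <= t)).
    { destruct Hcase as [H | [H | [H | [H | H]]]];
        [exists (- l - x) | exists ((x - y) / 2) | exists (y - l) | exists (- t)
        | exists (t - tau)]; lra. }
    destruct He as (e & e0 & He); exists e; split; [exact e0 |].
    intros x' y' t' (H1 & H2 & H3) HK'; unfold K in HK'.
    apply Rabs_def2 in H1; apply Rabs_def2 in H2; apply Rabs_def2 in H3; lra. }
  { intros x y t eps (H1 & H2 & H3 & H4) Heps.
    destruct (Dcont x t (eps / 2)) as (e & e0 & He); [lra | lra | lra |].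
    destruct (Dcont y t (eps / 2)) as (e' & e'0 & He'); [lra | lra | lra |].
    exists (Rmin e e'); split; [now apply Rmin_glb_lt |].
    intros x' y' t' (G1 & G2 & G3) (K1 & K2 & K3 & K4).
    pose proof (Rmin_l e e'). pose proof (Rmin_r e e').
    pose proof (He x' t' ltac:(lra) ltac:(lra) ltac:(lra) K4) as Hx'.
    pose proof (He' y' t' ltac:(lra) ltac:(lra) ltac:(lra) K4) as Hy'.
    apply Rabs_def2 in Hx'; apply Rabs_def2 in Hy'; lra. }
  { exists xx, yy, tt; repeat split; lra. }
  assert (Hxxyy : d yy tt - d xx tt <= d y t - d x t)
    by (apply Hmax; repeat split; lra).
  destruct (Rle_lt_dec (d y t - d x t) 0) as [Hpos | Hpos]; [lra | exfalso].
  assert (xy : x < y) by (destruct Hxy0 as [| ->]; lra).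
  assert (tpos : 0 < t).
  { destruct Ht0 as [[H | <-] Htau]; [exact H | exfalso].
    destruct (mean_value_open (fun z => d z 0)
      (fun z => v (rho + kappa * 0 + z) 0 - B z) x y xy) as (z & Hz & E).
    - intros z Hz; apply Dd; lra.
    - intros z Hz; apply is_derive_continuity_pt with (v (rho + kappa * 0 + z) 0 - B z),
        Dd; lra.
    - pose proof (init z ltac:(lra)) as Hi; rewrite Rmult_0_r, Rplus_0_r in E; nra. }
  assert (Hcx : cylinder r1 r2 T (rho + kappa * t + x, t)) by (apply tube; lra).
  assert (Hcy : cylinder r1 r2 T (rho + kappa * t + y, t)) by (apply tube; lra).
  destruct (Ht _ _ Hcx tpos) as (Lx & HLx & Htx).
  destruct (Ht _ _ Hcy tpos) as (Ly & HLy & Hty).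
  destruct (contact g (fun z => u (rho + kappa * t + z) t)
    (fun z => v (rho + kappa * t + z) t) psi B (P y) x y l Ly) as [Vy Py]; auto.
  { intros z Hz; apply Ud; lra. }
  { intros z Hz; apply unit; lra. }
  { intros z Hz; pose proof (barrier_range _ _ _ _ _ _ _ _ bar z); lra. }
  { apply (barrier_right _ _ _ _ _ _ _ _ bar). }
  { intros Hyl; apply (barrier_flux _ _ _ _ _ _ _ _ bar); lra. }
  { intros ->; apply (barrier_slope_right _ _ _ _ _ _ _ _ bar). }
  { now apply (is_derive_shift (fun z => g (v z t))). }
  { intros V1; destruct (flux_local_max g r1 r2 T u v _ t sol g_max Hcy V1)
      as (e & e0 & He); exists e; split; [exact e0 |]; intros h Hh.
    rewrite <- Rplus_assoc; now apply He. }
  { intros z Hz; assert (d z t - d x t <= d y t - d x t)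
      by (apply Hmax; repeat split; lra); unfold d in *; lra. }
  (* The minimum point [x] becomes a maximum point of the odd reflection. *)
  destruct (contact g (fun z => - u (rho + kappa * t + - z) t)
    (fun z => v (rho + kappa * t + - z) t) (fun z => - psi (- z)) (fun z => B (- z))
    (- P x) (- y) (- x) l (- Lx)) as [Vx Px]; auto.
  { lra. }
  { intros z Hz; apply (is_derive_reflect (fun z => u (rho + kappa * t + z) t)), Ud; lra. }
  { intros z Hz; apply is_derive_reflect, Hpsi. }
  { intros z Hz; apply unit; lra. }
  { intros z Hz; pose proof (barrier_range _ _ _ _ _ _ _ _ bar (- z)); lra. }
  { apply (barrier_left _ _ _ _ _ _ _ _ bar). }
  { intros Hyl.
    apply is_derive_ext with (fun z => - - g (B (- z))); [intros; apply Ropp_involutive |].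
    apply (is_derive_opp (fun z => - g (B (- z)))).
    apply (is_derive_reflect (fun z => g (B z))).
    rewrite Ropp_involutive; apply (barrier_flux _ _ _ _ _ _ _ _ bar); lra. }
  { intros Hxl; replace x with (- l) by lra.
    pose proof (barrier_slope_left _ _ _ _ _ _ _ _ bar); lra. }
  { apply is_derive_ext with (fun z => - - g (v (rho + kappa * t + - z) t));
      [intros; apply Ropp_involutive |].
    apply (is_derive_opp (fun z => - g (v (rho + kappa * t + - z) t))).
    apply (is_derive_reflect (fun z => g (v (rho + kappa * t + z) t))).
    rewrite Ropp_involutive; now apply (is_derive_shift (fun z => g (v z t))). }
  { rewrite Ropp_involutive; intros V1.
    destruct (flux_local_max g r1 r2 T u v _ t sol g_max Hcx V1)
      as (e & e0 & He); exists e; split; [exact e0 |]; intros h Hh.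
    replace (rho + kappa * t + - (- x + h)) with (rho + kappa * t + x + - h) by ring.
    apply He; now rewrite Rabs_Ropp. }
  { intros z Hz; rewrite Ropp_involutive.
    assert (d y t - d (- z) t <= d y t - d x t) by (apply Hmax; repeat split; lra).
    unfold d in *; lra. }
  rewrite Ropp_involutive in Vx.
  assert (Hder : forall z L, - l <= z <= l ->
    is_derive (fun s => u (rho + kappa * t + z) s) t
      (L + g (v (rho + kappa * t + z) t) / (rho + kappa * t + z)) ->
    is_derive (fun s => d z s) t (L + g (v (rho + kappa * t + z) t)
      / (rho + kappa * t + z) + kappa * v (rho + kappa * t + z) t)).
  { intros z L Hz HL.
    set (D := L + g (v (rho + kappa * t + z) t) / (rho + kappa * t + z)) in *.
    replace (D + kappa * v (rho + kappa * t + z) t)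
      with (D + kappa * v (rho + kappa * t + z) t - 0) by ring.
    apply (is_derive_sub (fun s => u (rho + kappa * s + z) s) (fun _ => psi z));
      [| apply (is_derive_const (K := R_AbsRing) (V := R_NormedModule))].
    apply is_derive_ext with (fun s => u (rho + z + kappa * s) s).
    { intros s; f_equal; ring. }
    replace (rho + kappa * t + z) with (rho + z + kappa * t) in HL |- * by ring.
    apply (is_derive_moving g r1 r2 T u v); auto.
    replace (rho + z + kappa * t) with (rho + kappa * t + z) by ring.
    apply tube; lra. }
  pose proof (is_derive_left_max _ t _ tpos
    (is_derive_sub _ _ _ _ _ (Hder y Ly ltac:(lra) Hty) (Hder x Lx ltac:(lra) Htx)))
    as Hfin.
  rewrite Vx, Vy in Hfin.
  pose proof (barrier_speed_decreasing _ _ _ _ _ _ _ _ bar (rho + kappa * t) x y) as Hdec.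
  destruct (tube (- l) t ltac:(lra) ltac:(lra)) as [[T1 _] _].
  destruct (tube l t ltac:(lra) ltac:(lra)) as [[_ T2] _]; simpl in T1, T2.
  specialize (Hdec ltac:(lra) ltac:(lra) Hx xy Hy).
  assert (Hfin' : forall s, 0 <= s <= t -> d y s - d x s <= d y t - d x t)
    by (intros s Hs; apply Hmax; repeat split; lra).
  specialize (Hfin Hfin'); lra.
Qed.

(** * Persistence of subcriticality in a tube *)

(** A Hopf-type argument. Since [B < 1] inside, [v = 1] can only occur at an edge of
    the tube. There the flux is at a local maximum, so its derivative is [0],
    while the barrier forces the flux to leave its maximum at a positive angle. *)
Lemma no_edge_contact (g : R -> R) (r1 r2 T : R) (u v : R -> R -> R)
  (rho kappa l t b0 : R) (B P : R -> R)
  (sol : solves g r1 r2 T u v)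
  (g_incr : increasing_on_unit g)
  (g_max : forall s, 0 <= s -> g s <= g 1)
  (l0 : 0 < l) (t0 : 0 < t)
  (bar : barrier g r1 r2 kappa l b0 B P)
  (tube : forall x, - l <= x <= l -> cylinder r1 r2 T (rho + kappa * t + x, t))
  (unit : forall x, - l <= x <= l -> -1 <= v (rho + kappa * t + x) t)
  (below : forall x, - l <= x <= l -> v (rho + kappa * t + x) t <= B x) :
  forall x, - l <= x <= l -> v (rho + kappa * t + x) t < 1.
Proof.
  intros x Hx; apply Rnot_le_lt; intros Hv.
  assert (V1 : v (rho + kappa * t + x) t = 1).
  { pose proof (below x Hx). pose proof (barrier_range _ _ _ _ _ _ _ _ bar x); lra. }
  destruct (barrier_edge_angle _ _ _ _ _ _ _ _ bar) as (beta & beta0 & Hbeta).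
  assert (B1 : B x = 1).
  { pose proof (below x Hx). pose proof (barrier_range _ _ _ _ _ _ _ _ bar x); lra. }
  assert (Hedge : Rabs x = l).
  { pose proof (Hbeta x Hx) as H; rewrite B1 in H.
    assert (Rabs x <= l) by (apply Rabs_le; lra).
    assert (beta * (l - Rabs x) <= 0) by lra; nra. }
  assert (HG : forall z, - l <= z <= l ->
    g (v (rho + kappa * t + z) t) <= g 1 - beta * (l - Rabs z)).
  { intros z Hz; apply Rle_trans with (2 := Hbeta z Hz).
    pose proof (barrier_range _ _ _ _ _ _ _ _ bar z).
    destruct (below z Hz) as [H' | ->]; [| lra].
    left; apply g_incr; [now apply unit | exact H' | lra]. }
  destruct (flux_local_max g r1 r2 T u v _ t sol g_max (tube x Hx) V1)
    as (e & e0 & He).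
  destruct sol as (_ & _ & _ & Ht).
  destruct (Ht _ _ (tube x Hx) t0) as (L & HL & _).
  rewrite (is_derive_local_max _ _ _ e HL e0 He) in HL.
  apply (is_derive_shift (fun z => g (v z t))) in HL.
  destruct (Rle_lt_dec 0 x) as [Hx0 | Hx0].
  - rewrite Rabs_right in Hedge by lra.
    destruct (is_derive_neg_strict
      (fun z => g (v (rho + kappa * t + z) t) - beta * z) x (0 - beta)) as (d & d0 & Hd).
    { apply (is_derive_sub (fun z => g (v (rho + kappa * t + z) t))); [exact HL |].
      auto_derive; [exact I | ring]. }
    { lra. }
    assert (m0 : 0 < Rmin d l) by now apply Rmin_glb_lt.
    pose proof (Rmin_l d l). pose proof (Rmin_r d l).
    pose proof (Hd (Rmin d l / 2) ltac:(lra)) as [_ H1].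
    pose proof (HG (x - Rmin d l / 2) ltac:(lra)) as H2.
    rewrite Rabs_right in H2 by lra; rewrite V1 in H1; subst l; lra.
  - rewrite Rabs_left in Hedge by lra.
    destruct (is_derive_pos_strict
      (fun z => g (v (rho + kappa * t + z) t) - - beta * z) x (0 - - beta))
      as (d & d0 & Hd).
    { apply (is_derive_sub (fun z => g (v (rho + kappa * t + z) t))); [exact HL |].
      auto_derive; [exact I | ring]. }
    { lra. }
    assert (m0 : 0 < Rmin d l) by now apply Rmin_glb_lt.
    pose proof (Rmin_l d l). pose proof (Rmin_r d l).
    pose proof (Hd (Rmin d l / 2) ltac:(lra)) as [_ H1].
    pose proof (HG (x + Rmin d l / 2) ltac:(lra)) as H2.
    rewrite Rabs_left in H2 by lra; rewrite V1 in H1; subst l; lra.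
Qed.

(** Take a first time [t] at which [Rabs v] reaches [1] in the tube. Up to time [t]
    the solution is subcritical in the closed tube, so [comparison] applies to
    [u] and to [- u], and [no_edge_contact] excludes [Rabs v = 1] at time [t]. *)
Lemma subcritical_tube (g : R -> R) (r1 r2 T : R) (u v : R -> R -> R)
  (rho kappa l tau b0 : R) (B P : R -> R)
  (sol : solves g r1 r2 T u v)
  (g_odd : forall s, g (- s) = - g s)
  (g_incr : increasing_on_unit g)
  (g_max : forall s, 0 <= s -> g s <= g 1)
  (l0 : 0 < l) (b0_unit : 0 <= b0 < 1)
  (bar : barrier g r1 r2 kappa l b0 B P)
  (tube : forall x t, - l <= x <= l -> 0 <= t <= tau ->
     cylinder r1 r2 T (rho + kappa * t + x, t))
  (init : forall x, - l <= x <= l -> Rabs (v (rho + x) 0) <= b0) :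
  forall x t, - l <= x <= l -> 0 <= t <= tau -> Rabs (v (rho + kappa * t + x) t) < 1.
Proof.
  intros x1 t1 Hx1 Ht1; apply Rnot_le_lt; intros Hbad.
  set (K := fun x y t => - l <= x <= l /\ - l <= y <= l /\ 0 <= t <= tau /\
    1 <= Rabs (v (rho + kappa * t + x) t)).
  pose proof sol as (_ & _ & Hv & _).
  assert (Hopen : forall x t, - l <= x <= l -> 0 <= t <= tau ->
    Rabs (v (rho + kappa * t + x) t) < 1 -> exists d, 0 < d /\
      forall x' t', Rabs (x' - x) < d -> Rabs (t' - t) < d -> - l <= x' <= l ->
        0 <= t' <= tau -> Rabs (v (rho + kappa * t' + x') t') < 1).
  { intros x t Hx Ht Hlt.
    destruct (moving_continuous r1 r2 T v rho kappa x t
      (1 - Rabs (v (rho + kappa * t + x) t)) Hv (tube x t Hx Ht))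
      as (d & d0 & Hd); [lra |].
    exists d; split; [exact d0 |]; intros x' t' H1 H2 H3 H4.
    pose proof (Hd x' t' H1 H2 (tube x' t' H3 H4)) as H5.
    pose proof (Rabs_triang_inv (v (rho + kappa * t' + x') t')
      (v (rho + kappa * t + x) t)); lra. }
  (* Maximising [- t] over the closed set of bad points yields the first bad
     time. *)
  destruct (usc_attains_max (- l) l tau K (fun _ _ t => - t))
    as (x & y & t & (Hx & Hy & Ht & Hvx) & Hmax).
  { unfold K; intros; tauto. }
  { intros x y t HK.
    destruct (classic (- l <= x <= l /\ - l <= y <= l /\ 0 <= t <= tau))
      as [(Hx & Hy & Ht) | Hout].
    - destruct (Hopen x t Hx Ht) as (d & d0 & Hd).
      { apply Rnot_le_lt; intros H; apply HK; repeat split; tauto. }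
      exists d; split; [exact d0 |].
      intros x' y' t' (H1 & H2 & H3) (K1 & K2 & K3 & K4).
      pose proof (Hd x' t' H1 H3 K1 K3); lra.
    - assert (He : exists e, 0 < e /\ (x + e <= - l \/ l + e <= x \/ y + e <= - l
        \/ l + e <= y \/ t + e <= 0 \/ tau + e <= t)).
      { assert (x < - l \/ l < x \/ y < - l \/ l < y \/ t < 0 \/ tau < t)
          as [H | [H | [H | [H | [H | H]]]]] by (apply NNPP; intros Hn; apply Hout; lra);
          [exists (- l - x) | exists (x - l) | exists (- l - y) | exists (y - l)
          | exists (- t) | exists (t - tau)]; lra. }
      destruct He as (e & e0 & He); exists e; split; [exact e0 |].
      intros x' y' t' (H1 & H2 & H3) (K1 & K2 & K3 & _).
      apply Rabs_def2 in H1; apply Rabs_def2 in H2; apply Rabs_def2 in H3; lra. }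
  { intros x y t eps _ Heps; exists eps; split; [exact Heps |].
    intros x' y' t' (_ & _ & H3) _; apply Rabs_def2 in H3; lra. }
  { exists x1, 0, t1; repeat split; lra. }
  assert (Hbefore : forall z s, - l <= z <= l -> 0 <= s < t ->
    Rabs (v (rho + kappa * s + z) s) < 1).
  { intros z s Hz Hs; apply Rnot_le_lt; intros H.
    assert (- s <= - t) by (apply (Hmax z 0); repeat split; lra); lra. }
  assert (t0 : 0 < t).
  { destruct (proj1 Ht) as [H | <-]; [exact H | exfalso].
    rewrite Rmult_0_r, Rplus_0_r in Hvx; pose proof (init x Hx); lra. }
  assert (Hupto : forall z s, - l <= z <= l -> 0 <= s <= t ->
    Rabs (v (rho + kappa * s + z) s) <= 1).
  { intros z s Hz [Hs0 [Hst | ->]]; [left; now apply Hbefore |].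
    apply Rnot_lt_le; intros H.
    destruct (moving_continuous r1 r2 T v rho kappa z t
      (Rabs (v (rho + kappa * t + z) t) - 1) Hv (tube z t Hz Ht))
      as (d & d0 & Hd); [lra |].
    assert (m0 : 0 < Rmin d t) by now apply Rmin_glb_lt.
    pose proof (Rmin_l d t). pose proof (Rmin_r d t).
    pose proof (Hbefore z (t - Rmin d t / 2) Hz ltac:(lra)) as Hb.
    pose proof (Hd z (t - Rmin d t / 2) ltac:(rewrite Rminus_diag, Rabs_R0; lra)
      ltac:(rewrite Rabs_left; lra) ltac:(apply tube; lra)) as Hc.
    rewrite Rabs_minus_sym in Hc.
    pose proof (Rabs_triang_inv (v (rho + kappa * t + z) t)
      (v (rho + kappa * (t - Rmin d t / 2) + z) (t - Rmin d t / 2))); lra. }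
  assert (tube' : forall z s, - l <= z <= l -> 0 <= s <= t ->
    cylinder r1 r2 T (rho + kappa * s + z, s)) by (intros; apply tube; lra).
  assert (Hlt : forall u' v', solves g r1 r2 T u' v' ->
    (forall z s, - l <= z <= l -> 0 <= s <= t ->
      Rabs (v' (rho + kappa * s + z) s) <= 1) ->
    (forall z, - l <= z <= l -> Rabs (v' (rho + z) 0) <= b0) ->
    v' (rho + kappa * t + x) t < 1).
  { intros u' v' Hsol Hunit Hinit.
    apply (no_edge_contact g r1 r2 T u' v' rho kappa l t b0 B P); auto.
    - intros z Hz; pose proof (Hunit z t Hz ltac:(lra)) as H; apply Rabs_le_between in H; lra.
    - intros z Hz; apply (comparison g r1 r2 T u' v' rho kappa l t b0 B P); auto; try lra.
      + intros w s Hw Hs; pose proof (Hunit w s Hw Hs) as H; apply Rabs_le_between in H; lra.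
      + intros w Hw; pose proof (Hinit w Hw) as H; apply Rabs_le_between in H.
        pose proof (barrier_range _ _ _ _ _ _ _ _ bar w); lra. }
  pose proof (Hlt u v sol Hupto init) as H1.
  assert (H2 : - v (rho + kappa * t + x) t < 1).
  { apply (Hlt (fun r s => - u r s) (fun r s => - v r s)).
    - now apply solves_opp.
    - intros z s Hz Hs; rewrite Rabs_Ropp; now apply Hupto.
    - intros z Hz; rewrite Rabs_Ropp; now apply init. }
  assert (Rabs (v (rho + kappa * t + x) t) < 1) by (apply Rabs_def1; lra); lra.
Qed.

(** * Construction of the barrier *)

Lemma Derive_of_is_derive (f : R -> R) (x l : R) :
  is_derive f x l -> Derive (fun z => f z) x = l.
Proof. exact (is_derive_unique f x l). Qed.

Lemma increasing_of_pos_derivative (g g1 : R -> R) (a b : R)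
  (g_der : forall s, is_derive g s (g1 s))
  (g1_pos : forall s, a < s < b -> 0 < g1 s) :
  forall x y, a <= x -> x < y -> y <= b -> g x < g y.
Proof.
  intros x y Hx Hxy Hy.
  destruct (mean_value_open g g1 x y Hxy) as (c & Hc & E).
  - intros; apply g_der.
  - intros z _; now apply is_derive_continuity_pt with (g1 z).
  - pose proof (g1_pos c ltac:(lra)); nra.
Qed.

(** Near the critical slope [1] the flux is quadratic, so the slope is controlled by
    the square root of the flux gap. The bound [4 a^2 (g 1 - g) <= (g')^2] holds
    because both sides vanish at [1] and [g'' <= - 2 a^2]; it makes
    [sqrt (g 1 - g s) + a * s] nonincreasing in [s]. *)
Lemma degenerate_flux_gap (g g1 g2 : R -> R) (b0 a : R)
  (g_der : forall s, is_derive g s (g1 s))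
  (g1_der : forall s, is_derive g1 s (g2 s))
  (g1_pos : forall s, b0 <= s < 1 -> 0 < g1 s) (g1_1 : g1 1 = 0)
  (a0 : 0 < a) (g2_neg : forall s, b0 <= s <= 1 -> g2 s <= - 2 * a ^ 2) :
  forall x y, b0 <= x -> x <= y -> y <= 1 ->
    a * (y - x) <= sqrt (g 1 - g x) - sqrt (g 1 - g y).
Proof.
  assert (g_incr : forall x y, b0 <= x -> x < y -> y <= 1 -> g x < g y).
  { apply (increasing_of_pos_derivative g g1); [exact g_der |].
    intros; apply g1_pos; lra. }
  assert (Hsq : forall s, b0 <= s < 1 -> 4 * a ^ 2 * (g 1 - g s) <= g1 s ^ 2).
  { intros s Hs.
    destruct (mean_value_open (fun z => g1 z ^ 2 - 4 * a ^ 2 * (g 1 - g z))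
      (fun z => 2 * g1 z * g2 z + 4 * a ^ 2 * g1 z) s 1 (proj2 Hs)) as (z & Hz & E).
    - intros z _; auto_derive.
      + split; [exists (g2 z); apply g1_der | split; [| exact I]].
        exists (g1 z); apply g_der.
      + rewrite (Derive_of_is_derive g1 _ _ (g1_der z)), (Derive_of_is_derive g _ _ (g_der z)).
        ring.
    - intros z _; apply is_derive_continuity_pt
        with (2 * g1 z * g2 z + 4 * a ^ 2 * g1 z); auto_derive.
      + split; [exists (g2 z); apply g1_der | split; [| exact I]].
        exists (g1 z); apply g_der.
      + rewrite (Derive_of_is_derive g1 _ _ (g1_der z)), (Derive_of_is_derive g _ _ (g_der z)).
        ring.
    - rewrite g1_1 in E.
      pose proof (g1_pos z ltac:(lra)). pose proof (g2_neg z ltac:(lra)).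
      assert ((2 * g1 z * g2 z + 4 * a ^ 2 * g1 z) <= 0) by nra.
      assert ((2 * g1 z * g2 z + 4 * a ^ 2 * g1 z) * (1 - s) <= 0) by nra.
      lra. }
  intros x y Hx [Hxy | ->] Hy; [| lra].
  set (f := fun z => - sqrt (g 1 - g z) - a * z).
  destruct (mean_value_open f (fun z => g1 z / (2 * sqrt (g 1 - g z)) - a) x y Hxy)
    as (z & Hz & E).
  - intros z Hz; pose proof (g_incr z 1 ltac:(lra) ltac:(lra) ltac:(lra)).
    assert (0 < sqrt (g 1 - g z)) by (apply sqrt_lt_R0; lra).
    unfold f; auto_derive.
    + repeat split; [exists (g1 z); apply g_der | lra].
    + rewrite (Derive_of_is_derive g _ _ (g_der z)); unfold Rminus; field.
      unfold Rminus in *; lra.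
  - intros z _; unfold f.
    apply continuity_pt_minus; [| apply derivable_continuous_pt; reg].
    apply continuity_pt_opp.
    apply (continuity_pt_comp (fun z => g 1 - g z) sqrt).
    + apply continuity_pt_minus; [apply continuity_pt_const; now intros ? ? |].
      now apply is_derive_continuity_pt with (g1 z).
    + apply continuity_pt_filterlim, continuous_sqrt.
  - pose proof (g_incr z 1 ltac:(lra) ltac:(lra) ltac:(lra)).
    assert (s0 : 0 < sqrt (g 1 - g z)) by (apply sqrt_lt_R0; lra).
    assert (ss : sqrt (g 1 - g z) * sqrt (g 1 - g z) = g 1 - g z)
      by (apply sqrt_sqrt; lra).
    pose proof (Hsq z ltac:(lra)) as Hz2. pose proof (g1_pos z ltac:(lra)).
    assert (2 * a * sqrt (g 1 - g z) <= g1 z).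
    { apply Rsqr_incr_0; unfold Rsqr; [| nra | lra].
      replace (2 * a * sqrt (g 1 - g z) * (2 * a * sqrt (g 1 - g z)))
        with (4 * a ^ 2 * (sqrt (g 1 - g z) * sqrt (g 1 - g z))) by ring.
      rewrite ss; lra. }
    assert (0 <= g1 z / (2 * sqrt (g 1 - g z)) - a).
    { replace (g1 z / (2 * sqrt (g 1 - g z)) - a)
        with ((g1 z - 2 * a * sqrt (g 1 - g z)) / (2 * sqrt (g 1 - g z)))
        by (field; lra).
      apply Rdiv_le_0_compat; lra. }
    assert (0 <= (g1 z / (2 * sqrt (g 1 - g z)) - a) * (y - x))
      by (apply Rmult_le_pos; lra).
    unfold f in E; lra.
Qed.

(** The term [w / r] of the equation, with [w] the flux, decreases at a rate close
    to [w / r ^ 2]. This is the only source of the expansion of the region. *)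
Lemma radial_term_decreasing (r1 r2 C d x y w1 w2 : R) :
  0 < r1 -> r1 <= x -> x < y -> y <= r2 -> 0 <= w1 -> w2 - w1 <= d * (y - x) ->
  0 <= d -> C <= w1 / r2 ^ 2 - d / r1 ->
  w2 / y - w1 / x <= - C * (y - x).
Proof.
  intros H0 Hx Hxy Hy Hw Hd d0 HC.
  replace (w2 / y - w1 / x) with ((w2 - w1) / y - w1 * (y - x) * / (x * y))
    by (field; lra).
  assert (H1 : (w2 - w1) / y <= d / r1 * (y - x)).
  { apply Rle_trans with (d * (y - x) / y).
    - apply Rmult_le_compat_r; [left; apply Rinv_0_lt_compat; lra | exact Hd].
    - replace (d / r1 * (y - x)) with (d * (y - x) / r1) by (field; lra).
      apply Rmult_le_compat_l; [apply Rmult_le_pos; lra |].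
      apply Rinv_le_contravar; lra. }
  assert (H2 : / r2 ^ 2 <= / (x * y)) by (apply Rinv_le_contravar; nra).
  assert (H3 : w1 * (y - x) * / r2 ^ 2 <= w1 * (y - x) * / (x * y)).
  { apply Rmult_le_compat_l; [apply Rmult_le_pos; lra | exact H2]. }
  assert (H4 : C * (y - x) <= (w1 / r2 ^ 2 - d / r1) * (y - x))
    by (apply Rmult_le_compat_r; lra).
  unfold Rdiv in *; lra.
Qed.

Lemma is_derive_comp_Rabs (f : R -> R) (x l : R) :
  is_derive f (Rabs x) l -> (x = 0 -> l = 0) ->
  is_derive (fun z => f (Rabs z)) x (sign x * l).
Proof.
  intros Hf Hl; destruct (Req_dec x 0) as [-> | Hx].
  - rewrite Hl by reflexivity; rewrite Rmult_0_r.
    rewrite Hl, Rabs_R0 in Hf by reflexivity.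
    apply is_derive_Reals in Hf; apply is_derive_Reals; intros eps Heps.
    destruct (Hf eps Heps) as [d Hd]; exists d; intros h h0 Hh.
    pose proof (Hd (Rabs h) (Rabs_no_R0 _ h0) ltac:(now rewrite Rabs_Rabsolu)) as H.
    rewrite Rplus_0_l in H |- *; rewrite Rabs_R0; rewrite Rminus_0_r in H |- *.
    unfold Rdiv in *; rewrite Rabs_mult, Rabs_inv in H |- *.
    now rewrite Rabs_Rabsolu in H.
  - replace (sign x * l) with (scal (sign x * 1) l)
      by (unfold scal; simpl; unfold mult; simpl; ring).
    apply (is_derive_comp f Rabs); [exact Hf |].
    apply (is_derive_Rabs (fun z => z)); [apply (is_derive_id (K := R_AbsRing)) | exact Hx].
Qed.

(** The barrier is defined through its flux gap [g 1 - g (B x)], a scaled profile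
    of height [b ^ 2 * l ^ 2]. Here [b ^ 2] is slightly below [g 1 / r2 ^ 2] and
    [2 * a ^ 2] is slightly below [- g'' 1], so that the bound [2 * a * b] on the
    speed is close to the critical one. The smallness hypotheses hold for every
    small half-width [l]. *)
Section BarrierConstruction.

Context (g g1 g2 : R -> R) (r1 r2 kappa b0 a b l : R).
Context (g_der : forall s, is_derive g s (g1 s)).
Context (g1_der : forall s, is_derive g1 s (g2 s)).
Context (g1_pos : forall s, b0 <= s < 1 -> 0 < g1 s).
Context (g1_1 : g1 1 = 0).
Context (a0 : 0 < a).
Context (g2_neg : forall s, b0 <= s <= 1 -> g2 s <= - 2 * a ^ 2).
Context (b0_lt : b0 < 1).
Context (r1_pos : 0 < r1).
Context (b_pos : 0 < b).
Context (l_pos : 0 < l).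
Context (kappa_le : Rabs kappa <= 2 * a * b).
Context (small_gap : b ^ 2 * l ^ 2 <= g 1 - g b0).
Context (flux_floor : 0 <= g b0).
Context (small_curv : b ^ 2 <= (g 1 - b ^ 2 * l ^ 2) / r2 ^ 2 - b ^ 2 * l / r1).

(** Distance to the nearest edge of the tube, relative to [l]. Clamping at [0] keeps
    the barrier defined and continuous on the whole line, as its primitive
    requires. *)
Definition depth (x : R) : R := Rmax 0 (1 - Rabs x / l).

Lemma depth_unit (x : R) : 0 <= depth x <= 1.
Proof.
  unfold depth; split; [apply Rmax_l |].
  apply Rmax_lub; [lra |].
  assert (0 <= Rabs x / l) by (apply Rdiv_le_0_compat; [apply Rabs_pos | lra]); lra.
Qed.

Lemma depth_inside (x : R) : Rabs x <= l -> depth x = 1 - Rabs x / l.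
Proof.
  intros Hx; unfold depth; apply Rmax_right.
  assert (Rabs x / l <= 1); [| lra].
  apply Rmult_le_reg_r with l; [lra |]; field_simplify; lra.
Qed.

Definition gap (x : R) : R := b ^ 2 * l ^ 2 * profile (depth x).

Lemma profile_unit (x : R) : 0 <= x <= 1 -> 0 <= profile x <= 1.
Proof.
  intros Hx; pose proof (profile_increment 0 x); rewrite profile_0 in H; lra.
Qed.

Lemma gap_range (x : R) : 0 <= gap x <= b ^ 2 * l ^ 2.
Proof.
  pose proof (profile_unit _ (depth_unit x)).
  assert (0 <= b ^ 2 * l ^ 2) by (apply Rmult_le_pos; apply pow2_ge_0).
  unfold gap; nra.
Qed.

Lemma sqrt_gap (x : R) : sqrt (gap x) = b * l * sqrt (profile (depth x)).
Proof.
  unfold gap; rewrite sqrt_mult;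
    [| nra | apply profile_unit, depth_unit].
  f_equal; replace (b ^ 2 * l ^ 2) with ((b * l) * (b * l)) by ring.
  apply sqrt_square; nra.
Qed.

Lemma barrier_value_exists (x : R) :
  {s | Rmin b0 1 <= s <= Rmax b0 1 /\ g s = g 1 - gap x}.
Proof.
  apply IVT_gen.
  - intros s; apply is_derive_continuity_pt with (g1 s), g_der.
  - pose proof (gap_range x).
    pose proof (pow2_ge_0 b). pose proof (pow2_ge_0 l).
    rewrite Rmin_left, Rmax_right by nra; lra.
Qed.

Definition barrier_value (x : R) : R := proj1_sig (barrier_value_exists x).
Definition barrier_slope (x : R) : R :=
  sign x * (b ^ 2 * l * profile_slope (1 - Rabs x / l)).

Lemma barrier_value_range (x : R) : b0 <= barrier_value x <= 1.
Proof.
  pose proof (proj2_sig (barrier_value_exists x)) as [H _].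
  change (Rmin b0 1 <= barrier_value x <= Rmax b0 1) in H.
  rewrite Rmin_left, Rmax_right in H by lra; exact H.
Qed.

Lemma flux_barrier_value (x : R) : g (barrier_value x) = g 1 - gap x.
Proof. exact (proj2 (proj2_sig (barrier_value_exists x))). Qed.

Lemma barrier_value_increment (x y : R) :
  a * Rabs (barrier_value y - barrier_value x) <= Rabs (sqrt (gap y) - sqrt (gap x)).
Proof.
  assert (H : forall x y, barrier_value x <= barrier_value y ->
    a * (barrier_value y - barrier_value x) <= sqrt (gap x) - sqrt (gap y)).
  { intros x' y' Hxy.
    pose proof (degenerate_flux_gap g g1 g2 b0 a g_der g1_der g1_pos g1_1 a0 g2_neg
      (barrier_value x') (barrier_value y')) as H.
    rewrite !flux_barrier_value in H.
    replace (g 1 - (g 1 - gap x')) with (gap x') in H by ring.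
    replace (g 1 - (g 1 - gap y')) with (gap y') in H by ring.
    apply H; [apply barrier_value_range | exact Hxy | apply barrier_value_range]. }
  destruct (Rle_lt_dec (barrier_value x) (barrier_value y)) as [Hxy | Hxy].
  - rewrite Rabs_minus_sym, (Rabs_minus_sym (sqrt _)).
    rewrite (Rabs_left1 (barrier_value x - barrier_value y)) by lra.
    apply Rle_trans with (2 := Rle_abs _); pose proof (H x y Hxy); lra.
  - rewrite (Rabs_left (barrier_value y - barrier_value x)) by lra.
    apply Rle_trans with (2 := Rle_abs _); pose proof (H y x ltac:(lra)); lra.
Qed.

Lemma barrier_value_continuous (x : R) : continuous barrier_value x.
Proof.
  assert (Hgap : continuity_pt (fun z => sqrt (gap z)) x).
  { apply (continuity_pt_comp gap sqrt);
      [| apply continuity_pt_filterlim, continuous_sqrt].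
    apply continuity_pt_mult; [apply continuity_pt_const; now intros ? ? |].
    apply (continuity_pt_comp depth profile); [| apply profile_continuous].
    intros eps Heps; exists (eps * l); split; [apply Rmult_lt_0_compat; lra |].
    intros y [_ Hy]; simpl in Hy |- *; unfold Rdist in *.
    apply Rle_lt_trans with (Rabs (y - x) / l).
    2:{ apply Rmult_lt_reg_r with l; [lra |]; field_simplify; lra. }
    assert (Hd : Rabs (Rabs y / l - Rabs x / l) <= Rabs (y - x) / l).
    { replace (Rabs y / l - Rabs x / l) with ((Rabs y - Rabs x) * / l) by (field; lra).
      rewrite Rabs_mult, (Rabs_right (/ l))
        by (apply Rle_ge; left; now apply Rinv_0_lt_compat).
      apply Rmult_le_compat_r; [left; now apply Rinv_0_lt_compat |].
      apply Rabs_triang_inv2. }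
    apply Rabs_le_between in Hd.
    unfold depth, Rmax; repeat destruct Rle_dec; apply Rabs_le; lra. }
  apply continuity_pt_filterlim; intros eps Heps.
  destruct (Hgap (a * eps)) as (d & d0 & Hd); [apply Rmult_lt_0_compat; lra |].
  exists d; split; [exact d0 |]; intros y Hy; specialize (Hd y Hy).
  simpl in Hd |- *; unfold Rdist in *.
  apply Rmult_lt_reg_l with a; [exact a0 |].
  apply Rle_lt_trans with (1 := barrier_value_increment x y); exact Hd.
Qed.

Lemma barrier_value_edge (x : R) : Rabs x = l -> barrier_value x = 1.
Proof.
  intros Hx; pose proof (flux_barrier_value x) as H.
  unfold gap in H; rewrite depth_inside, Hx in H by lra.
  replace (1 - l / l) with 0 in H by (field; lra); rewrite profile_0 in H.
  pose proof (barrier_value_range x) as [H1 [H2 | H2]]; [exfalso | exact H2].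
  assert (g (barrier_value x) < g 1); [| lra].
  apply (increasing_of_pos_derivative g g1 b0 1); auto; try lra.
  intros; apply g1_pos; lra.
Qed.

Lemma is_derive_flux_barrier (x : R) : - l < x < l ->
  is_derive (fun z => g (barrier_value z)) x (barrier_slope x).
Proof.
  intros Hx; assert (Hax : Rabs x < l) by now apply Rabs_def1.
  apply is_derive_ext_loc with
    (fun z => g 1 - b ^ 2 * l ^ 2 * profile (1 - Rabs z / l)).
  { assert (e0 : 0 < l - Rabs x) by lra.
    exists (mkposreal _ e0); intros y Hy; change (Rabs (y - x) < l - Rabs x) in Hy.
    pose proof (Rabs_triang_inv y x).
    rewrite flux_barrier_value; unfold gap; rewrite depth_inside; [reflexivity | lra]. }
  apply (is_derive_comp_Rabs (fun z => g 1 - b ^ 2 * l ^ 2 * profile (1 - z / l))).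
  - assert (Hp : 0 < 1 - Rabs x / l).
    { assert (Rabs x / l < 1); [| lra].
      apply Rmult_lt_reg_r with l; [lra |]; field_simplify; lra. }
    pose proof (is_derive_profile _ Hp) as H.
    auto_derive; [exists (profile_slope (1 - Rabs x / l)); exact H |].
    change (1 + - (Rabs x * / l)) with (1 - Rabs x / l).
    rewrite (Derive_of_is_derive profile _ _ H); field; lra.
  - intros ->; rewrite Rabs_R0; unfold profile_slope.
    replace (1 - 0 / l) with 1 by (field; lra); rewrite sqrt_1; field.
Qed.

Lemma barrier_slope_nonneg (x : R) : 0 <= x <= l ->
  barrier_slope x = b ^ 2 * l * profile_slope (depth x).
Proof.
  intros Hx; rewrite depth_inside by (apply Rabs_le; lra); unfold barrier_slope.
  destruct (proj1 Hx) as [H | <-].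
  - rewrite sign_eq_1 by exact H; ring.
  - rewrite sign_0, Rabs_R0; unfold profile_slope.
    replace (1 - 0 / l) with 1 by (field; lra); rewrite sqrt_1; field.
Qed.

Lemma barrier_slope_nonpos (x : R) : - l <= x <= 0 ->
  barrier_slope x = - (b ^ 2 * l * profile_slope (depth x)).
Proof.
  intros Hx; rewrite depth_inside by (apply Rabs_le; lra); unfold barrier_slope.
  destruct (proj2 Hx) as [H | ->].
  - rewrite sign_eq_m1 by exact H; ring.
  - rewrite sign_0, Rabs_R0; unfold profile_slope.
    replace (1 - 0 / l) with 1 by (field; lra); rewrite sqrt_1; field.
Qed.

(** The speed hypothesis enters here: transport at speed [kappa] costs no more than
    the last term of [profile_subsolution]. *)
Lemma transport_increment (x y : R) :
  Rabs (kappa * (barrier_value y - barrier_value x))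
  <= 2 * b ^ 2 * l * Rabs (sqrt (profile (depth y)) - sqrt (profile (depth x))).
Proof.
  pose proof (barrier_value_increment x y) as H; rewrite !sqrt_gap in H.
  rewrite <- Rmult_minus_distr_l, Rabs_mult, (Rabs_right (b * l)) in H
    by (apply Rle_ge, Rmult_le_pos; lra).
  rewrite Rabs_mult.
  set (D := Rabs (sqrt _ - sqrt _)) in *; set (E := Rabs (barrier_value y - _)) in *.
  assert (0 <= E) by apply Rabs_pos.
  apply Rle_trans with (2 * a * b * E); [now apply Rmult_le_compat_r |].
  replace (2 * a * b * E) with (2 * b * (a * E)) by ring.
  replace (2 * b ^ 2 * l * D) with (2 * b * (b * l * D)) by ring.
  apply Rmult_le_compat_l; lra.
Qed.

Lemma sqrt_profile_mono (x y : R) : 0 <= x -> x <= y -> y <= 1 ->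
  sqrt (profile x) <= sqrt (profile y).
Proof.
  intros Hx Hxy Hy; apply sqrt_le_1_alt.
  pose proof (profile_increment x y Hx Hxy Hy); lra.
Qed.

(** In terms of [depth], the three increments add up to [b ^ 2 * l] times an
    increment of the quantity in [profile_subsolution]. On each half of the tube
    [depth] is monotone; the centre lies in both halves. *)
Lemma barrier_speed (rho x y : R) :
  r1 <= rho - l -> rho + l <= r2 -> - l <= x -> x < y -> y <= l ->
  barrier_slope y + g (barrier_value y) / (rho + y) + kappa * barrier_value y
  < barrier_slope x + g (barrier_value x) / (rho + x) + kappa * barrier_value x.
Proof.
  intros Hr1 Hr2 Hx Hxy Hy.
  assert (Hbl : 0 < b ^ 2 * l) by (apply Rmult_lt_0_compat; [apply pow_lt |]; lra).
  assert (Hrad : forall x y, - l <= x -> x < y -> y <= l ->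
    Rabs (depth y - depth x) <= (y - x) / l ->
    g (barrier_value y) / (rho + y) - g (barrier_value x) / (rho + x)
    <= - b ^ 2 * (y - x)).
  { clear x y Hx Hxy Hy; intros x y Hx Hxy Hy Hdep.
    pose proof (gap_range x). rewrite !flux_barrier_value.
    replace (y - x) with (rho + y - (rho + x)) by ring.
    replace (- b ^ 2) with (- (b ^ 2)) by ring.
    apply (radial_term_decreasing r1 r2 _ (b ^ 2 * l)); try lra.
    - replace (rho + y - (rho + x)) with (y - x) by ring.
      replace (b ^ 2 * l * (y - x)) with (b ^ 2 * l ^ 2 * ((y - x) / l)) by (field; lra).
      replace (g 1 - gap y - (g 1 - gap x)) with (gap x - gap y) by ring.
      unfold gap; rewrite <- Rmult_minus_distr_l.
      apply Rmult_le_compat_l; [nra |].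
      pose proof (depth_unit x). pose proof (depth_unit y).
      apply Rabs_le_between in Hdep.
      destruct (Rle_lt_dec (depth y) (depth x)) as [Hd | Hd].
      + pose proof (profile_increment (depth y) (depth x)); lra.
      + pose proof (profile_increment (depth x) (depth y)).
        assert (0 <= (y - x) / l) by (apply Rdiv_le_0_compat; lra); lra.
    - apply Rle_trans with (1 := small_curv).
      apply Rplus_le_compat_r, Rmult_le_compat_r; [| lra].
      left; apply Rinv_0_lt_compat, pow_lt; lra. }
  assert (Hright : forall x y, 0 <= x -> x < y -> y <= l ->
    barrier_slope y + g (barrier_value y) / (rho + y) + kappa * barrier_value y
    < barrier_slope x + g (barrier_value x) / (rho + x) + kappa * barrier_value x).
  { clear x y Hx Hxy Hy; intros x y Hx Hxy Hy.
    assert (Dx : depth x = 1 - x / l)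
      by (rewrite depth_inside; rewrite Rabs_right; lra).
    assert (Dy : depth y = 1 - y / l)
      by (rewrite depth_inside; rewrite Rabs_right; lra).
    assert (Hxy' : depth x - depth y = (y - x) / l) by (rewrite Dx, Dy; field; lra).
    assert (Hpos : 0 < (y - x) / l) by (apply Rdiv_lt_0_compat; lra).
    pose proof (Hrad x y ltac:(lra) Hxy Hy ltac:(rewrite Rabs_left; lra)) as H1.
    pose proof (transport_increment x y) as H2.
    pose proof (depth_unit x). pose proof (depth_unit y).
    pose proof (profile_subsolution (depth y) (depth x)
      ltac:(lra) ltac:(lra) ltac:(lra)) as H3.
    pose proof (sqrt_profile_mono (depth y) (depth x) ltac:(lra) ltac:(lra) ltac:(lra)).
    rewrite (Rabs_left1 (sqrt _ - sqrt _)) in H2 by lra.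
    apply Rabs_le_between in H2; destruct H2 as [_ H2].
    rewrite !barrier_slope_nonneg by lra.
    replace (- b ^ 2 * (y - x)) with (- (b ^ 2 * l * (depth x - depth y))) in H1
      by (rewrite Hxy'; field; lra).
    apply (Rmult_lt_compat_l _ _ _ Hbl) in H3; lra. }
  assert (Hleft : forall x y, - l <= x -> x < y -> y <= 0 ->
    barrier_slope y + g (barrier_value y) / (rho + y) + kappa * barrier_value y
    < barrier_slope x + g (barrier_value x) / (rho + x) + kappa * barrier_value x).
  { clear x y Hx Hxy Hy; intros x y Hx Hxy Hy.
    assert (Dx : depth x = 1 + x / l)
      by (rewrite depth_inside; rewrite Rabs_left1; lra).
    assert (Dy : depth y = 1 + y / l)
      by (rewrite depth_inside; rewrite Rabs_left1; lra).
    assert (Hxy' : depth y - depth x = (y - x) / l) by (rewrite Dx, Dy; field; lra).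
    assert (Hpos : 0 < (y - x) / l) by (apply Rdiv_lt_0_compat; lra).
    pose proof (Hrad x y ltac:(lra) Hxy ltac:(lra) ltac:(rewrite Rabs_right; lra)) as H1.
    pose proof (transport_increment x y) as H2.
    pose proof (depth_unit x). pose proof (depth_unit y).
    pose proof (profile_subsolution (depth x) (depth y)
      ltac:(lra) ltac:(lra) ltac:(lra)) as H3.
    pose proof (sqrt_profile_mono (depth x) (depth y) ltac:(lra) ltac:(lra) ltac:(lra)).
    rewrite (Rabs_right (sqrt _ - sqrt _)) in H2 by lra.
    apply Rabs_le_between in H2; destruct H2 as [_ H2].
    rewrite !barrier_slope_nonpos by lra.
    replace (- b ^ 2 * (y - x)) with (- (b ^ 2 * l * (depth y - depth x))) in H1
      by (rewrite Hxy'; field; lra).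
    apply (Rmult_lt_compat_l _ _ _ Hbl) in H3; lra. }
  destruct (Rle_lt_dec 0 x) as [H0 | H0]; [now apply Hright |].
  destruct (Rle_lt_dec y 0) as [H0' | H0']; [now apply Hleft |].
  apply Rlt_trans with (2 := Hleft x 0 Hx H0 (Rle_refl 0)).
  apply Hright; lra.
Qed.

Lemma barrier_of_profile : barrier g r1 r2 kappa l b0 barrier_value barrier_slope.
Proof.
  assert (Hbl : 0 < b ^ 2 * l) by (apply Rmult_lt_0_compat; [apply pow_lt |]; lra).
  split.
  - exact barrier_value_continuous.
  - exact barrier_value_range.
  - apply barrier_value_edge; rewrite Rabs_Ropp; apply Rabs_right; lra.
  - apply barrier_value_edge, Rabs_right; lra.
  - exact is_derive_flux_barrier.
  - rewrite barrier_slope_nonpos by lra.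
    pose proof (profile_slope_bounds _ (depth_unit (- l))); nra.
  - rewrite barrier_slope_nonneg by lra.
    pose proof (profile_slope_bounds _ (depth_unit l)); nra.
  - exact barrier_speed.
  - exists (b ^ 2 * l / 6400); split; [lra |]; intros x Hx.
    assert (Hax : Rabs x <= l) by now apply Rabs_le.
    rewrite flux_barrier_value; unfold gap.
    pose proof (profile_ge _ (depth_unit x)) as H.
    assert (E : b ^ 2 * l / 6400 * (l - Rabs x) = b ^ 2 * l ^ 2 * (depth x / 6400)).
    { rewrite depth_inside by exact Hax; field; lra. }
    rewrite E.
    assert (b ^ 2 * l ^ 2 * (depth x / 6400) <= b ^ 2 * l ^ 2 * profile (depth x));
      [apply Rmult_le_compat_l; nra | lra].
Qed.

End BarrierConstruction.

(** * The expanding subcritical region *)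

Lemma barrier_exists (g g1 g2 : R -> R) (r1 r2 kappa b0 a b : R)
  (g_der : forall s, is_derive g s (g1 s))
  (g1_der : forall s, is_derive g1 s (g2 s))
  (g_0 : g 0 = 0)
  (g1_pos : forall s, 0 <= s < 1 -> 0 < g1 s) (g1_1 : g1 1 = 0)
  (a_pos : 0 < a) (g2_neg : forall s, b0 <= s <= 1 -> g2 s <= - 2 * a ^ 2)
  (b0_unit : 0 < b0 < 1) (r1_pos : 0 < r1) (r12 : r1 < r2) (b_pos : 0 < b)
  (b_lt : b ^ 2 < g 1 / r2 ^ 2) (kappa_le : Rabs kappa <= 2 * a * b) :
  exists l0, 0 < l0 /\ forall l, 0 < l <= l0 ->
    exists B P, barrier g r1 r2 kappa l b0 B P.
Proof.
  assert (g_incr : forall x y, 0 <= x -> x < y -> y <= 1 -> g x < g y).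
  { apply (increasing_of_pos_derivative g g1); [exact g_der |].
    intros; apply g1_pos; lra. }
  pose proof (g_incr 0 b0 ltac:(lra) ltac:(lra) ltac:(lra)) as Hb0.
  pose proof (g_incr b0 1 ltac:(lra) ltac:(lra) ltac:(lra)) as Hb1.
  assert (b2 : 0 < b ^ 2) by now apply pow_lt.
  assert (r22 : 0 < / r2 ^ 2) by (apply Rinv_0_lt_compat, pow_lt; lra).
  assert (r1i : 0 < / r1) by now apply Rinv_0_lt_compat.
  set (A := b ^ 2 * (/ r2 ^ 2 + / r1)).
  assert (A0 : 0 < A) by (apply Rmult_lt_0_compat; lra).
  assert (Hpos : 0 < Rmin (Rmin 1 ((g 1 - g b0) / b ^ 2)) ((g 1 / r2 ^ 2 - b ^ 2) / A)).
  { repeat apply Rmin_glb_lt; try apply Rdiv_lt_0_compat; lra. }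
  exists (Rmin (Rmin 1 ((g 1 - g b0) / b ^ 2)) ((g 1 / r2 ^ 2 - b ^ 2) / A)).
  split; [exact Hpos |]; intros l [l0 Hl].
  assert (l1 : l <= 1).
  { apply Rle_trans with (1 := Hl), Rle_trans with (1 := Rmin_l _ _), Rmin_l. }
  assert (l2 : l * b ^ 2 <= g 1 - g b0).
  { apply Rle_div_r; [exact b2 |].
    apply Rle_trans with (1 := Hl), Rle_trans with (1 := Rmin_l _ _), Rmin_r. }
  assert (l4 : l * A <= g 1 / r2 ^ 2 - b ^ 2).
  { apply Rle_div_r; [exact A0 |].
    apply Rle_trans with (1 := Hl), Rmin_r. }
  assert (ll : l ^ 2 <= l) by nra.
  assert (small_gap : b ^ 2 * l ^ 2 <= g 1 - g b0) by nra.
  assert (small_curv : b ^ 2 <= (g 1 - b ^ 2 * l ^ 2) / r2 ^ 2 - b ^ 2 * l / r1).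
  { assert (b ^ 2 * l ^ 2 * / r2 ^ 2 <= b ^ 2 * l * / r2 ^ 2).
    { apply Rmult_le_compat_r; [lra |]; apply Rmult_le_compat_l; lra. }
    unfold A, Rdiv in *; lra. }
  eexists; eexists; unshelve eapply (barrier_of_profile g g1 g2 r1 r2 kappa b0 a b l);
    auto; try lra.
  intros s Hs; apply g1_pos; lra.
Qed.

(** At positive times the restriction of the increments to [0 <= s < T] is void. *)
Lemma is_derive_of_is_partial_t (T : R) (u : R -> R -> R) (r t l : R) :
  0 < t < T -> is_partial_t T u r t l -> is_derive (fun s => u r s) t l.
Proof.
  intros Ht [Hlin Hdom]; split; [exact Hlin |]; intros x Hx eps.
  assert (Ht0 : locally t (fun s => 0 <= s < T)).
  { assert (m0 : 0 < Rmin t (T - t)) by (apply Rmin_glb_lt; lra).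
    exists (mkposreal _ m0); intros s Hs; change (Rabs (s - t) < Rmin t (T - t)) in Hs.
    pose proof (Rmin_l t (T - t)). pose proof (Rmin_r t (T - t)).
    apply Rabs_def2 in Hs; lra. }
  assert (Hlim : is_filter_lim (within (fun s => 0 <= s < T) (locally t)) x).
  { intros Q HQ; apply filter_imp with (2 := Hx Q HQ); tauto. }
  pose proof (filter_and _ _ Ht0 (Hdom x Hlim eps)) as H.
  apply filter_imp with (2 := H); intros s [H1 H2]; now apply H2.
Qed.

Section Flux.

Context (phi : R -> R).
Context (phi_smooth : smooth phi).
Context (phi_even : forall x, phi (- x) = phi x).
Context (phi2_pos : forall x, 0 <= x < 1 -> 0 < Derive_n phi 2 x).
Context (phi2_neg : forall x, 1 < x -> Derive_n phi 2 x < 0).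

Lemma is_derive_flux (x : R) : is_derive (Derive phi) x (Derive_n phi 2 x).
Proof. apply Derive_correct, (phi_smooth 2%nat x). Qed.

Lemma flux_odd (x : R) : Derive phi (- x) = - Derive phi x.
Proof.
  assert (H : is_derive phi (- x) (- Derive phi x)); [| now apply is_derive_unique].
  apply is_derive_ext with (fun z => - - phi (- z)).
  { intros z; now rewrite Ropp_involutive. }
  apply (is_derive_opp (fun z => - phi (- z))), is_derive_reflect.
  rewrite Ropp_involutive; apply Derive_correct, (phi_smooth 1%nat x).
Qed.

Lemma flux_0 : Derive phi 0 = 0.
Proof. pose proof (flux_odd 0) as H; rewrite Ropp_0 in H; lra. Qed.

Lemma flux_increasing : increasing_on_unit (Derive phi).
Proof.
  assert (H : forall x y, 0 <= x -> x < y -> y <= 1 -> Derive phi x < Derive phi y).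
  { apply (increasing_of_pos_derivative _ (Derive_n phi 2)); [apply is_derive_flux |].
    intros; apply phi2_pos; lra. }
  assert (Hneg : forall x y, -1 <= x -> x < y -> y <= 0 ->
    Derive phi x < Derive phi y).
  { intros x y Hx Hxy Hy; pose proof (H (- y) (- x)) as H'.
    rewrite !flux_odd in H'; lra. }
  intros x y Hx Hxy Hy.
  destruct (Rle_lt_dec 0 x) as [H0 | H0]; [now apply H |].
  destruct (Rle_lt_dec y 0) as [H0' | H0']; [now apply Hneg |].
  apply Rlt_trans with (Derive phi 0); [apply Hneg | apply H]; lra.
Qed.

(** At very negative slopes the flux may exceed [Derive phi 1]. *)
Lemma flux_max (s : R) : 0 <= s -> Derive phi s <= Derive phi 1.
Proof.
  intros Hs; destruct (Rtotal_order s 1) as [H | [-> | H]]; [| lra |].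
  - left; apply flux_increasing; lra.
  - destruct (mean_value_open (Derive phi) (Derive_n phi 2) 1 s H) as (z & Hz & E).
    + intros; apply is_derive_flux.
    + intros z _; apply is_derive_continuity_pt with (Derive_n phi 2 z), is_derive_flux.
    + pose proof (phi2_neg z ltac:(lra)); nra.
Qed.

End Flux.

Lemma solves_radial_equation (phi : R -> R) (r1 r2 T : R) (u : R -> R -> R) :
  C1_cylinder r1 r2 T u -> radial_equation phi r1 r2 T u ->
  solves (Derive phi) r1 r2 T u (partial_r u).
Proof.
  intros (Hu & Hr & Hv & _) Heq.
  refine (conj _ (conj _ (conj _ _))).
  - intros r t Hc; now apply Derive_correct, Hr.
  - now apply continuous_on_cylinder.
  - now apply continuous_on_cylinder.
  - intros r t Hc t0; destruct (Heq r t Hc) as [H1 H2].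
    exists (partial_r (flux phi u) r t); split.
    + now apply Derive_correct in H1.
    + apply (is_derive_of_is_partial_t T); [| exact H2].
      destruct Hc as [_ Ht]; simpl in Ht; lra.
Qed.

(** Every point of the expanding region is reached from the initial interval along
    a segment that is strictly slower than the edges of the region. *)
Lemma oblique_segment (r3 r4 k r t : R) : r3 < r4 -> 0 < k -> 0 < t ->
  r3 - k * t < r < r4 + k * t ->
  exists rho kappa, r3 < rho < r4 /\ Rabs kappa < k /\ r = rho + kappa * t.
Proof.
  intros H34 k0 t0 Hr; assert (kt : 0 < k * t) by now apply Rmult_lt_0_compat.
  assert (Hrho : exists rho, r3 < rho < r4 /\ - (k * t) < r - rho < k * t).
  { set (lo := Rmax r3 (r - k * t)); set (hi := Rmin r4 (r + k * t)).
    assert (r3 <= lo) by apply Rmax_l. assert (r - k * t <= lo) by apply Rmax_r.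
    assert (hi <= r4) by apply Rmin_l. assert (hi <= r + k * t) by apply Rmin_r.
    assert (lo < hi) by (apply Rmax_lub_lt; apply Rmin_glb_lt; lra).
    exists ((lo + hi) / 2); lra. }
  destruct Hrho as (rho & H1 & H2); exists rho, ((r - rho) / t).
  split; [exact H1 | split; [| field; lra]].
  apply Rabs_def1.
  - apply Rlt_div_l; lra.
  - apply Rlt_div_r; lra.
Qed.

Theorem theorem2p2 (phi : R -> R) (r1 r2 r3 r4 T : R) (u : R -> R -> R)
  (phi_smooth : smooth phi)
  (phi_even : forall x, phi (- x) = phi x)
  (phi2_pos : forall x, 0 <= x < 1 -> 0 < Derive_n phi 2 x)
  (phi2_1 : Derive_n phi 2 1 = 0)
  (phi2_neg : forall x, 1 < x -> Derive_n phi 2 x < 0)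
  (phi3_1 : Derive_n phi 3 1 < 0)
  (r1_pos : 0 < r1) (r13 : r1 <= r3) (r34 : r3 < r4) (r42 : r4 <= r2)
  (T_pos : 0 < T)
  (u_C1 : C1_cylinder r1 r2 T u)
  (u_eq : radial_equation phi r1 r2 T u)
  (u_init : forall r, r3 < r < r4 -> Rabs (partial_r u r 0) < 1) :
  forall r t, expanding_region (speed phi r2) r1 r2 r3 r4 T (r, t) ->
    Rabs (partial_r u r t) < 1.
Proof.
  intros r t [[[Hr1 Hr2] [Ht0 HtT]] Hr]; simpl in Hr1, Hr2, Ht0, HtT, Hr.
  destruct Ht0 as [t0 | <-].
  2:{ rewrite Rmult_0_r in Hr; apply u_init; lra. }
  set (g := Derive phi) in *.
  pose proof (flux_increasing phi phi_smooth phi_even phi2_pos) as g_incr.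
  pose proof (flux_max phi phi_smooth phi_even phi2_pos phi2_neg) as g_max.
  pose proof (flux_odd phi phi_smooth phi_even) as g_odd.
  pose proof (flux_0 phi phi_smooth phi_even) as g_0.
  fold g in g_incr, g_max, g_odd, g_0.
  pose proof (solves_radial_equation phi r1 r2 T u u_C1 u_eq) as sol; fold g in sol.
  assert (c0 : 0 < g 1) by (rewrite <- g_0; apply g_incr; lra).
  set (m := - Derive_n phi 3 1).
  assert (m0 : 0 < m) by (unfold m; lra).
  assert (k0_sqr : 0 < speed phi r2 /\ speed phi r2 ^ 2 = 2 * g 1 * m / r2 ^ 2).
  { unfold speed; rewrite Rabs_left by exact phi3_1; fold m; fold g.
    assert (cm : 0 < 2 * g 1 * m) by (apply Rmult_lt_0_compat; lra).
    split.
    - apply Rmult_lt_0_compat; [apply Rinv_0_lt_compat; lra | now apply sqrt_lt_R0].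
    - rewrite Rpow_mult_distr, pow2_sqrt by lra; field; lra. }
  destruct k0_sqr as [k0 k0_sqr]; set (k := speed phi r2) in *.
  destruct (oblique_segment r3 r4 _ r t r34 k0 t0 Hr) as (rho & kappa & Hrho & Hk & Er).
  (* The strict inequality [Rabs kappa < k] is shared between the two parameters
     [a] and [b] of the barrier, so that [2 * a * b = theta * k >= Rabs kappa]. *)
  set (theta := (1 + Rabs kappa / k) / 2).
  assert (Hkk : 0 <= Rabs kappa / k < 1).
  { split; [apply Rdiv_le_0_compat; [apply Rabs_pos | exact k0] |].
    apply Rlt_div_l; lra. }
  assert (th : 0 < theta < 1) by (unfold theta; lra).
  assert (Hkth : Rabs kappa <= theta * k).
  { unfold theta; replace ((1 + Rabs kappa / k) / 2 * k) with ((k + Rabs kappa) / 2)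
      by (field; lra); lra. }
  set (a := sqrt (theta * m / 2)). set (b := sqrt (theta * g 1) / r2).
  assert (tm : 0 < theta * m) by (apply Rmult_lt_0_compat; lra).
  assert (tc : 0 < theta * g 1) by (apply Rmult_lt_0_compat; lra).
  assert (a0 : 0 < a) by (apply sqrt_lt_R0; lra).
  assert (b_pos : 0 < b) by (apply Rdiv_lt_0_compat; [now apply sqrt_lt_R0 | lra]).
  assert (a2 : a ^ 2 = theta * m / 2) by (apply pow2_sqrt; lra).
  assert (b2 : b ^ 2 = theta * g 1 / r2 ^ 2).
  { unfold b, Rdiv; rewrite Rpow_mult_distr, pow2_sqrt, pow_inv by lra; reflexivity. }
  assert (Hab : theta * k = 2 * a * b).
  { apply Rsqr_inj; [nra | nra |]; rewrite !Rsqr_pow2, !Rpow_mult_distr, a2, b2, k0_sqr.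
    field; lra. }
  destruct (is_derive_continuity_pt (Derive_n phi 3) 1 (Derive_n phi 4 1)
    (Derive_correct _ _ (phi_smooth 4%nat 1)) (m - theta * m)) as (d & d0 & Hd).
  { nra. }
  (* On a slightly smaller initial interval the slope stays away from [1]. *)
  set (lr := Rmin (rho - r3) (r4 - rho) / 2).
  assert (lr0 : 0 < Rmin (rho - r3) (r4 - rho)) by (apply Rmin_glb_lt; lra).
  pose proof (Rmin_l (rho - r3) (r4 - rho)). pose proof (Rmin_r (rho - r3) (r4 - rho)).
  destruct (continuity_ab_maj (fun x => Rabs (partial_r u x 0)) (rho - lr) (rho + lr))
    as (xm & Hxm & Hxm').
  { unfold lr; lra. }
  { intros x Hx; apply (continuity_pt_comp (fun x => partial_r u x 0) Rabs);
      [| apply Rcontinuity_abs].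
    intros eps Heps; destruct sol as (_ & _ & Hv & _).
    assert (Hcx : cylinder r1 r2 T (x, 0)) by (split; simpl; unfold lr in Hx; lra).
    destruct (Hv x 0 eps Hcx Heps) as (e & e0 & He).
    assert (n0 : 0 < Rmin e (Rmin (x - r1) (r2 - x))).
    { destruct Hcx as [Hcx _]; simpl in Hcx; repeat apply Rmin_glb_lt; lra. }
    pose proof (Rmin_l e (Rmin (x - r1) (r2 - x))).
    pose proof (Rmin_r e (Rmin (x - r1) (r2 - x))).
    pose proof (Rmin_l (x - r1) (r2 - x)). pose proof (Rmin_r (x - r1) (r2 - x)).
    exists (Rmin e (Rmin (x - r1) (r2 - x))); split; [exact n0 |].
    intros y [_ Hy]; simpl in Hy |- *; unfold Rdist in *.
    assert (Hy' := Rabs_def2 _ _ Hy).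
    apply He; [lra | rewrite Rminus_diag, Rabs_R0; lra | split; simpl; lra]. }
  set (vm := Rabs (partial_r u xm 0)).
  assert (vm1 : vm < 1) by (apply u_init; unfold lr in Hxm'; lra).
  set (b0 := Rmax (Rmax (1 / 2) vm) (1 - d / 2)).
  assert (b0_1 : 1 / 2 <= b0)
    by (apply Rle_trans with (2 := Rmax_l _ _), Rmax_l).
  assert (b0_2 : vm <= b0) by (apply Rle_trans with (2 := Rmax_l _ _), Rmax_r).
  assert (b0_3 : 1 - d / 2 <= b0) by apply Rmax_r.
  assert (b0_lt : b0 < 1) by (repeat apply Rmax_lub_lt; lra).
  destruct (barrier_exists g (Derive_n phi 2) (Derive_n phi 3) r1 r2 kappa b0 a b)
    as (l0 & l00 & Hbar); auto; try lra.
  { apply is_derive_flux, phi_smooth. }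
  { intros s; apply Derive_correct, (phi_smooth 3%nat s). }
  { intros s Hs; destruct (Req_dec s 1) as [-> | Hne].
    - rewrite a2; unfold m in *; nra.
    - assert (Hs' : Rabs (Derive_n phi 3 s - Derive_n phi 3 1) < m - theta * m).
      { apply (Hd s); split; [split; [exact I | congruence] |].
        simpl; unfold Rdist; apply Rabs_def1; lra. }
      apply Rabs_def2 in Hs'; rewrite a2; unfold m in *; lra. }
  { rewrite b2; apply Rmult_lt_compat_r; [apply Rinv_0_lt_compat, pow_lt; lra | nra]. }
  set (mg := Rmin (Rmin (rho - r1) (r2 - rho)) (Rmin (r - r1) (r2 - r))).
  assert (mg0 : 0 < mg) by (repeat apply Rmin_glb_lt; lra).
  assert (mg1 : mg <= rho - r1)
    by (apply Rle_trans with (1 := Rmin_l _ _), Rmin_l).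
  assert (mg2 : mg <= r2 - rho)
    by (apply Rle_trans with (1 := Rmin_l _ _), Rmin_r).
  assert (mg3 : mg <= r - r1)
    by (apply Rle_trans with (1 := Rmin_r _ _), Rmin_l).
  assert (mg4 : mg <= r2 - r)
    by (apply Rle_trans with (1 := Rmin_r _ _), Rmin_r).
  set (l := Rmin (Rmin l0 lr) (mg / 2)).
  assert (l_pos : 0 < l) by (unfold l, lr; repeat apply Rmin_glb_lt; lra).
  assert (l1 : l <= l0) by (apply Rle_trans with (1 := Rmin_l _ _), Rmin_l).
  assert (l2 : l <= lr) by (apply Rle_trans with (1 := Rmin_l _ _), Rmin_r).
  assert (l3 : l <= mg / 2) by apply Rmin_r.
  destruct (Hbar l) as (B & P & HB); [lra |].
  pose proof (subcritical_tube g r1 r2 T u (partial_r u) rho kappa l t b0 B P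
    sol g_odd g_incr g_max l_pos ltac:(lra) HB) as Htube.
  rewrite Er; replace (rho + kappa * t) with (rho + kappa * t + 0) by ring.
  apply Htube; [| | lra | lra].
  - intros x s Hx Hs.
    assert (Hs1 : exists w, 0 <= w <= 1 /\ kappa * s = w * (kappa * t)).
    { exists (s / t); split; [| field; lra]; split.
      - apply Rdiv_le_0_compat; lra.
      - apply Rle_div_l; lra. }
    (* The axis of the tube joins [rho] to [r], two points of the interval
       ([r1], [r2]) at distance at least [mg] from its ends. *)
    destruct Hs1 as (w & Hw & ->).
    replace (kappa * t) with (r - rho) by lra.
    assert (- w * (rho - r1 - mg) <= 0) by nra.
    split; simpl; [| lra].
    split; nra.
  - intros x Hx; apply Rle_trans with (2 := b0_2); apply Hxm; unfold l in *; lra.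
Qed.
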